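(* Let $(\Omega,\mathcal{H},\hat{\mathbb{E}})$ be a sublinear expectation space (with $\hat{\mathbb{E}}$ countably sub-additive), and let $\{X_n,n\ge 1\}$ be a sequence of independent random variables in $\mathcal{H}$, each identically distributed as $X$. Let $r>1$, $p>\tfrac12$, $\beta$ real with $\beta+p>0$, and in the case $\tfrac12<p\le 1$ assume additionally $\hat{\mathbb{E}}[X]=-\hat{\mathbb{E}}[-X]=0$. Let $\{a_{ni}:0\le i\le n-1,\ n\ge 1\}$ be a triangular array of real numbers with $a_{ni}\approx ((n-i)/n)^{\beta}(1/n)^{p}$. Then the following are equivalent: (i) $C_{\mathbb{V}}\big(|X|^{(r-1)/(p+\beta)}\big)<\infty$ if $-p<\beta<-p/r$; $C_{\mathbb{V}}\big(|X|^{r/p}\ln(1+|X|)\big)<\infty$ if $\beta=-p/r$; $C_{\mathbb{V}}\big(|X|^{r/p}\big)<\infty$ if $\beta>-p/r$. (ii) For every $\epsilon>0$, $$\sum_{n=1}^{\infty}n^{r-2}\,\mathbb{V}\Big(\max_{0\le j\le n-1}\Big|\sum_{i=1}^{j}a_{ni}X_i\Big|>\epsilon\Big)<\infty.$$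
   Context: Sublinear expectation space: $(\Omega,\mathcal{F})$ is a measurable space and $\mathcal{H}$ a set of random variables on it containing all indicators $I_A$, $A\in\mathcal{F}$, and closed under $(X_1,\dots,X_n)\mapsto\varphi(X_1,\dots,X_n)$ for every locally Lipschitz $\varphi$ with $|\varphi(x)-\varphi(y)|\le C(1+|x|^m+|y|^m)|x-y|$. A sublinear expectation $\hat{\mathbb{E}}:\mathcal{H}\to[-\infty,\infty]$ is monotone, constant preserving ($\hat{\mathbb{E}}[c]=c$), positively homogeneous ($\hat{\mathbb{E}}[\lambda X]=\lambda\hat{\mathbb{E}}[X]$ for $\lambda\ge0$), and sub-additive ($\hat{\mathbb{E}}[X+Y]\le\hat{\mathbb{E}}[X]+\hat{\mathbb{E}}[Y]$ when the right side is not $\infty-\infty$). It is assumed countably sub-additive: $\hat{\mathbb{E}}[X]\le\sum_n\hat{\mathbb{E}}[X_n]$ whenever $0\le X\le\sum_n X_n$, $X_n\ge0$. Capacity: $\mathbb{V}(A)=\inf\{\hat{\mathbb{E}}[\xi]: I_A\le\xi,\ \xi\in\mathcal{H}\}$. Choquet expectation: $C_{\mathbb{V}}(X)=\int_0^\infty\mathbb{V}(X>x)\,dx+\int_{-\infty}^0(\mathbb{V}(X>x)-1)\,dx$. Independence: a random vector $\mathbf{Y}$ is independent of $\mathbf{X}$ if $\hat{\mathbb{E}}[\psi(\mathbf{X},\mathbf{Y})]=\hat{\mathbb{E}}\big[\hat{\mathbb{E}}[\psi(\mathbf{x},\mathbf{Y})]|_{\mathbf{x}=\mathbf{X}}\big]$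 for every Borel $\psi$ with $\psi(\mathbf{X},\mathbf{Y}),\psi(\mathbf{x},\mathbf{Y})\in\mathcal{H}$, whenever $\bar\psi(\mathbf{x}):=\hat{\mathbb{E}}[|\psi(\mathbf{x},\mathbf{Y})|]<\infty$ for all $\mathbf{x}$ and $\hat{\mathbb{E}}[|\bar\psi(\mathbf{X})|]<\infty$; $\{X_n\}$ is independent if $X_{n+1}$ is independent of $(X_1,\dots,X_n)$ for each $n$. Identically distributed: $\hat{\mathbb{E}}[\psi(X_i)]=\hat{\mathbb{E}}[\psi(X)]$ for every Borel $\psi$ for which these are defined and finite. Notation: $a_{ni}\approx b_{ni}$ means there are constants $0<c\le C<\infty$, independent of $i,n$, with $c\,b_{ni}\le a_{ni}\le C\,b_{ni}$. *)

(* Defs.v *)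
From HB Require Import structures.
From mathcomp Require Import all_boot all_order all_algebra.
From mathcomp Require Import all_classical all_reals all_analysis.
Set Implicit Arguments. Unset Strict Implicit. Unset Printing Implicit Defensive.
Import Order.TTheory GRing.Theory Num.Theory.
Import numFieldNormedType.Exports.
Local Open Scope classical_set_scope.
Local Open Scope ring_scope.

Section SublinearDefs.
Context {d : measure_display} {Omega : measurableType d} {R : realType}.
Implicit Types (H : set (Omega -> R)) (E : (Omega -> R) -> \bar R).

(* l^1 norm on R^n (all norms on R^n are equivalent, so the resulting
   class of locally Lipschitz functions is the same). *)
Definition nrm1 n (x : 'I_n -> R) : R := \sum_(i < n) `|x i|.

Definition locLip n (phi : ('I_n -> R) -> R) : Prop :=
  exists (C : R) (m : nat), 0 <= C /\ forall x y : 'I_n -> R,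
    `|phi x - phi y| <= C * (1 + nrm1 x ^+ m + nrm1 y ^+ m) * nrm1 (fun i => x i - y i).

Definition sublinear_space H E : Prop :=
      (forall X, H X -> measurable_fun setT X) /\
      (forall A : set Omega, measurable A -> H (\1_A)) /\
      (forall n (phi : ('I_n -> R) -> R) (Xv : 'I_n -> Omega -> R),
          locLip phi -> (forall i, H (Xv i)) -> H (fun w => phi (fun i => Xv i w))) /\
      (forall X Y, H X -> H Y -> (forall w, X w <= Y w) -> (E X <= E Y)%E) /\
      (forall c : R, E (fun _ => c) = c%:E) /\
      (forall X (l : R), H X -> 0 <= l -> E (fun w => l * X w) = (l%:E * E X)%E) /\
      (forall X Y, H X -> H Y ->
         ~ (E X = +oo%E /\ E Y = -oo%E) -> ~ (E X = -oo%E /\ E Y = +oo%E) ->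
         (E (fun w => (X w + Y w)%R) <= E X + E Y)%E) /\
      (forall X (Xn : nat -> Omega -> R), H X -> (forall k, H (Xn k)) ->
         (forall w, 0 <= X w) -> (forall k w, 0 <= Xn k w) ->
         (forall w, ((X w)%:E <= \sum_(0 <= k <oo) (Xn k w)%:E)%E) ->
         (E X <= \sum_(0 <= k <oo) E (Xn k))%E).

Definition capV H E (A : set Omega) : \bar R :=
  ereal_inf [set E xi | xi in [set xi | H xi /\ forall w, \1_A w <= xi w]].

Definition choquetE (V : set Omega -> \bar R) (X : Omega -> R) : \bar R :=
  ((\int[@lebesgue_measure R]_(x in [set x : R | (0 <= x)%R]) V [set w | (x < X w)%R])
  + (\int[@lebesgue_measure R]_(x in [set x : R | (x < 0)%R]) (V [set w | (x < X w)%R] - 1)))%E.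

Definition borel1 (psi : R -> R) : Prop :=
  forall c : R, <<s [set [set t : R | t < c'] | c' in [set: R]] >> [set t | psi t < c].

Definition borel2 n (psi : ('I_n -> R) -> R -> R) : Prop :=
  forall c : R,
    <<s [set A : set (('I_n -> R) * R) |
          (exists (i : 'I_n) (c' : R), A = [set z | z.1 i < c']) \/
          (exists c' : R, A = [set z | z.2 < c'])] >>
      [set z | psi z.1 z.2 < c].

Definition indep H E n (Xv : 'I_n -> Omega -> R) (Y : Omega -> R) : Prop :=
  forall psi : ('I_n -> R) -> R -> R, borel2 psi ->
    H (fun w => psi (fun i => Xv i w) (Y w)) ->
    (forall x, H (fun w => psi x (Y w))) ->
    let psibar := fun x => fine (E (fun w => `|psi x (Y w)|)) in
    let h := fun x => fine (E (fun w => psi x (Y w))) in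
    (forall x, (E (fun w => `|psi x (Y w)|%R) < +oo)%E) ->
    H (fun w => psibar (fun i => Xv i w)) ->
    (E (fun w => `|psibar (fun i => Xv i w)|%R) < +oo)%E ->
    H (fun w => h (fun i => Xv i w)) ->
    E (fun w => psi (fun i => Xv i w) (Y w)) = E (fun w => h (fun i => Xv i w)).

Definition ident_distr H E (X Y : Omega -> R) : Prop :=
  forall psi : R -> R, borel1 psi -> H (psi \o X) -> H (psi \o Y) ->
    E (psi \o X) \is a fin_num -> E (psi \o Y) \is a fin_num ->
    E (psi \o X) = E (psi \o Y).

End SublinearDefs.

(* Main.v *)
Require Import Defs.
From HB Require Import structures.
From mathcomp Require Import all_boot all_order all_algebra.
From mathcomp Require Import all_classical all_reals all_analysis.
From mathcomp Require Import measurable_realfun.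
From mathcomp Require Import ring lra zify.
Import Order.TTheory GRing.Theory Num.Theory.
Import numFieldNormedType.Exports.
Local Open Scope classical_set_scope.
Local Open Scope ring_scope.

(* Write F(x) = V(|X| > x) and k = n - i, so that a_{ni} is of order
   n^-(p+beta) k^beta. Both conditions are equivalent to
     sum_n n^(r-2) sum_{1 <= k < n} F(D n^(p+beta) k^(-beta)) < oo  for all D > 0.
   Only the monotonicity of F is used to compare this double series with the
   Choquet integrals: over dyadic blocks n ~ 2^m, k ~ 2^(m-j) it becomes
   sum_m sum_{j <= m} 2^(mr-j) F(D 2^(mp + j beta)), and for g = -beta/p the
   shift m = s + jg reduces it to sum_s w(s) F(D 2^(sp)), where
   w(s) / 2^(sr) = sum_{j <= s/(1-g)} 2^(j(gr-1)) is bounded, linear or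
   geometric in s according to the sign of gr - 1: this is the trichotomy in beta.

   (ii) => (i). Two consecutive partial sums differ by a_{ni} X_i, and
   independence gives V(max_i |a_{ni} X_i| > t) = 1 - prod_i (1 - F(t / a_{ni})),
   since the indicators U_i of the unions satisfy U_{i+1} = U_i + (1 - U_i) 1_{A_i}.

   (i) => (ii). Truncate a_{ni} X_i at level eta. For nonnegative functions g_i of
   the X_i, stopping the product of the g_i when it exceeds lam yields
   V(max_j prod_{i < j} g_i > lam) <= lam^-1 prod_i max(1, E g_i). It is applied to
   quadratic majorants of exp(+-t a_{ni} X_i) with t proportional to ln n; since the
   truncated first and second moments sum to O(n^-sigma) for some sigma > 0, a small
   eta makes the bound O(n^-r). *)

(** * Series with bounded partial sums *)

(** As the expectation is only sublinear, conditioning on the past is computable for expressions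
    [A + B * g (X_n)] with [A], [B] functions of the past and [B >= 0]: for a fixed past the inner
    expectation is then [A + B * E g]. The stopped product and the indicator of a union are
    therefore defined by recursions of this shape. The exponential bound rests on a moment of order
    q with 1/p < q < r/p: it is finite under (i) because pq < r, while pq > 1 and p + beta > 0 make
    sum_i a_{ni}^q decay like a negative power of n. Since p > 1/2 one can take q <= 2, as the
    truncated second moment requires. If p <= 1 then q > 1 and the truncated mean is controlled by
    centering; if p > 1 one takes q <= 1 and bounds absolute values. In (ii) => (i), 1 - exp(-x) has
    to be turned back into x: the weights n^(r-1) of the dyadic blocks tend to infinity, which
    forces x to be small. *)

Section RealSeries.
Set Implicit Arguments. Unset Strict Implicit. Unset Printing Implicit Defensive.
Context {R : realType}.
Implicit Types (u v : nat -> R) (x y : R).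

Definition bsum u := exists B : R, forall N, \sum_(0 <= i < N) u i <= B.

Lemma bsum_le C u v : 0 <= C -> (forall n, u n <= C * v n) -> bsum v -> bsum u.
Proof.
move=> C0 uv [B hB]; exists (C * B) => N.
apply: le_trans (ler_wpM2l C0 (hB N)); rewrite mulr_sumr.
by apply: ler_sum_nat => i _; exact: uv.
Qed.

Lemma bsumD u v : bsum u -> bsum v -> bsum (fun n => u n + v n).
Proof.
move=> [B hB] [C hC]; exists (B + C) => N.
by rewrite big_split; apply: lerD.
Qed.

Lemma bsum_finite (N0 : nat) u : (forall n, (N0 <= n)%N -> u n = 0) -> bsum u.
Proof.
move=> h; exists (\sum_(0 <= i < N0) `|u i|) => N.
have [NN|/ltnW NN] := leqP N0 N.
  rewrite (big_cat_nat (leq0n N0) NN)/= [X in _ + X]big_nat_cond.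
  rewrite [X in _ + X]big1 ?addr0; last by move=> i /andP[/andP[/h]].
  by apply: ler_sum => i _; exact: ler_norm.
rewrite (big_cat_nat (leq0n N) NN)/=.
apply: ler_wpDr; first by apply: sumr_ge0.
by apply: ler_sum => i _; exact: ler_norm.
Qed.

Lemma bsum_eventually (N0 : nat) C u v : 0 <= C -> (forall n, 0 <= v n) ->
  (forall n, (N0 <= n)%N -> u n <= C * v n) -> bsum v -> bsum u.
Proof.
move=> C0 v0 h bv.
have b1 : bsum (fun n => C * v n).
  by apply: (bsum_le (C:=C)) bv => // n.
have b2 : bsum (fun n => if (n < N0)%N then `|u n| else 0).
  by apply: (bsum_finite (N0:=N0)) => n; rewrite leqNgt => /negbTE ->.
apply: (bsum_le (C:=1)) (bsumD b1 b2) => // n; rewrite mul1r.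
case: ltnP => hn; last by rewrite addr0; exact: h.
by apply: ler_wpDl; [exact: mulr_ge0|exact: ler_norm].
Qed.

Lemma bsum_bounded u : (forall n, 0 <= u n) -> bsum u ->
  exists B : R, 0 < B /\ forall n, u n <= B.
Proof.
move=> u0 [B hB]; exists (`|B| + 1); split; first by rewrite ltr_wpDl.
move=> n; apply: (@le_trans _ _ B); last by rewrite ler_wpDr// ler_norm.
apply: le_trans (hB n.+1); rewrite big_nat_recr//= ler_wpDl//.
exact: sumr_ge0.
Qed.

Lemma sum_geo_le x N : 0 <= x -> x < 1 -> \sum_(0 <= i < N) x ^+ i <= (1 - x)^-1.
Proof.
move=> x0 x1; have h : 0 < 1 - x by rewrite subr_gt0.
rewrite -[X in _ <= X]mul1r ler_pdivlMr// mulrC.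
have -> : (1 - x) * \sum_(0 <= i < N) x ^+ i = 1 - x ^+ N.
  elim: N => [|N IH]; first by rewrite big_geq// mulr0 expr0 subrr.
  by rewrite big_nat_recr//= mulrDr IH exprS; ring.
by rewrite gerBl exprn_ge0.
Qed.

Lemma bsum_geo x : 0 <= x -> x < 1 -> bsum (fun n => x ^+ n).
Proof. by move=> x0 x1; exists (1 - x)^-1 => N; exact: sum_geo_le. Qed.

(** All powers are brought to this form, so that comparing them becomes, through [tw_le], a linear
    inequality between exponents. *)
Definition tw x : R := 2 `^ x.

Lemma twD x y : tw (x + y) = tw x * tw y.
Proof. by rewrite /tw powRD// pnatr_eq0 implybT. Qed.
Lemma tw_gt0 x : 0 < tw x. Proof. exact: powR_gt0. Qed.
Lemma tw_ge0 x : 0 <= tw x. Proof. exact: ltW (tw_gt0 x). Qed.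
Lemma tw_le x y : x <= y -> tw x <= tw y.
Proof. by apply: ler_powR; rewrite ler1n. Qed.
Lemma tw0 : tw 0 = 1. Proof. exact: powRr0. Qed.
Lemma twn (n : nat) : tw n%:R = (2 ^ n)%:R.
Proof. by rewrite /tw powR_mulrn// natrX. Qed.
Lemma twM x y : tw (x * y) = tw x `^ y. Proof. exact: powRrM. Qed.
Lemma twMn x (n : nat) : tw (n%:R * x) = tw x ^+ n.
Proof. by rewrite mulrC twM powR_mulrn// tw_ge0. Qed.
Lemma twN x : tw (- x) = (tw x)^-1. Proof. exact: powRN. Qed.
Lemma tw_ge1 x : 0 <= x -> 1 <= tw x.
Proof. by move=> x0; rewrite -tw0 tw_le. Qed.
Lemma tw_lt1 x : x < 0 -> tw x < 1.
Proof.
move=> x0; rewrite -[x]opprK twN invf_lt1 ?tw_gt0//.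
by rewrite /tw /powR pnatr_eq0/= expR_gt1 mulr_gt0 ?oppr_gt0 ?ln_gt0 ?ltr1n.
Qed.

Lemma tw_ge_lin x : x * ln 2 <= tw x.
Proof.
rewrite /tw /powR pnatr_eq0/=; apply: le_trans (expR_ge1Dx _).
by rewrite lerDr.
Qed.

Lemma bsum_tw x : x < 0 -> bsum (fun n => tw (n%:R * x)).
Proof.
move=> x0; case: (bsum_geo (tw_ge0 x) (tw_lt1 x0)) => B hB; exists B => N.
by apply: le_trans (hB N); apply: ler_sum => i _; rewrite twMn.
Qed.

Lemma sum_dyadic u M : \sum_(1 <= n < 2 ^ M) u n =
  \sum_(0 <= m < M) \sum_(2 ^ m <= n < 2 ^ m.+1) u n.
Proof.
elim: M => [|M IH]; first by rewrite !big_geq.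
rewrite big_nat_recr//= -IH -big_cat_nat ?expn_gt0//=.
by rewrite leq_exp2l.
Qed.

Lemma sum_block_le m u c : (forall n, (2 ^ m <= n < 2 ^ m.+1)%N -> u n <= c) ->
  \sum_(2 ^ m <= n < 2 ^ m.+1) u n <= tw m%:R * c.
Proof.
move=> h; apply: (@le_trans _ _ (\sum_(2 ^ m <= n < 2 ^ m.+1) c)).
  exact: ler_sum_nat.
by rewrite sumr_const_nat twn expnS mul2n -addnn addnK mulr_natl.
Qed.

Lemma sum_block_ge m u c : (forall n, (2 ^ m <= n < 2 ^ m.+1)%N -> c <= u n) ->
  tw m%:R * c <= \sum_(2 ^ m <= n < 2 ^ m.+1) u n.
Proof.
move=> h; apply: (@le_trans _ _ (\sum_(2 ^ m <= n < 2 ^ m.+1) c)); last first.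
  exact: ler_sum_nat.
by rewrite sumr_const_nat twn expnS mul2n -addnn addnK mulr_natl.
Qed.

(** [n] lies within a factor 2 of [2 ^ m], and powers are monotone in a direction given by the sign
    of [x]; the slack [|x|] covers both signs. *)
Lemma block_powR m n x : (2 ^ m <= n < 2 ^ m.+1)%N ->
  tw (m%:R * x - `|x|) <= n%:R `^ x <= tw (m%:R * x + `|x|).
Proof.
move=> /andP[mn nm].
have n0 : (0 : R) < n%:R by rewrite ltr0n (leq_trans _ mn)// expn_gt0.
have h1 : tw m%:R <= n%:R by rewrite twn ler_nat.
have h2 : n%:R <= tw m.+1%:R by rewrite twn ler_nat ltnW.
have [x0|x0] := leP 0 x.
  rewrite ger0_norm//; apply/andP; split.
    apply: (@le_trans _ _ (tw (m%:R * x))); first by rewrite tw_le// gerBl.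
    by rewrite twM ge0_ler_powR// ?nnegrE ?tw_ge0// ltW.
  have -> : m%:R * x + x = m.+1%:R * x by rewrite -nat1r; ring.
  by rewrite twM ge0_ler_powR// ?nnegrE ?tw_ge0// ltW.
rewrite ltr0_norm// opprK.
have -> : m%:R * x + x = m.+1%:R * x by rewrite -nat1r; ring.
have nx : 0 <= - x by rewrite oppr_ge0 ltW.
have K (a : R) : a `^ x = (a `^ (- x))^-1 by rewrite powRN invrK.
apply/andP; split.
  rewrite twM K [X in _ <= X]K lef_pV2 ?posrE ?powR_gt0 ?tw_gt0//.
  by rewrite ge0_ler_powR// ?nnegrE ?tw_ge0// ltW.
apply: (@le_trans _ _ (tw (m%:R * x))); last by rewrite tw_le// lerDl.
rewrite twM K [X in _ <= X]K lef_pV2 ?posrE ?powR_gt0 ?tw_gt0//.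
by rewrite ge0_ler_powR// ?nnegrE ?tw_ge0// ltW.
Qed.

Lemma ltn2X n : (n < 2 ^ n)%N. Proof. exact: ltn_expl. Qed.

(* Cauchy condensation: only dyadic partial sums need to be controlled. *)
Lemma bsum_condense u v : (forall n, 0 <= u n) -> u 0%N = 0 ->
  (forall m, \sum_(2 ^ m <= n < 2 ^ m.+1) u n <= v m) -> bsum v -> bsum u.
Proof.
move=> u0 u00 h [B hB]; exists B => N; apply: le_trans (hB N).
apply: (@le_trans _ _ (\sum_(0 <= n < 2 ^ N) u n)).
  rewrite (@big_cat_nat _ _ _ N _ (2 ^ N))/= ?(ltnW (ltn2X _))//.
  by rewrite lerDl; apply: sumr_ge0.
rewrite big_ltn ?expn_gt0// u00 add0r sum_dyadic.
by apply: ler_sum_nat => m _; exact: h.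
Qed.

Lemma bsum_blocks u v : (forall n, 0 <= u n) ->
  (forall m, v m <= \sum_(2 ^ m <= n < 2 ^ m.+1) u n) -> bsum u -> bsum v.
Proof.
move=> u0 h [B hB]; exists B => M; apply: le_trans (hB (2 ^ M)%N).
rewrite [X in _ <= X]big_ltn ?expn_gt0// sum_dyadic ler_wpDl//.
by apply: ler_sum_nat => m _; exact: h.
Qed.

Lemma bsum_powR s : s < -1 -> bsum (fun n => if n is 0 then 0 else n%:R `^ s).
Proof.
move=> s1; pose v m : R := tw `|s| * tw (m%:R * (1 + s)).
apply: (bsum_condense (v:=v)) => //.
- by case=> // n; exact: powR_ge0.
- move=> m; apply: le_trans (@sum_block_le m _ (tw (m%:R * s + `|s|)) _) _.
    move=> [|n] hn; first by move: hn; rewrite leqn0 expn_eq0.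
    by have /andP[] := block_powR s hn.
  by rewrite /v -!twD tw_le//; lra.
- apply: (@bsum_le (tw `|s|)) (bsum_tw (x:=1 + s) _) => //; first exact: tw_ge0.
  by lra.
Qed.

End RealSeries.

(** * Dyadic reduction of the double series *)

Section DyadicReduction.
Set Implicit Arguments. Unset Strict Implicit. Unset Printing Implicit Defensive.
Context {R : realType} (F : R -> R).
Context (F0 : forall x, 0 <= F x).
Context (Fanti : forall x y, x <= y -> F y <= F x).
Context (p beta r : R).
Implicit Types (D : R).

(* [F] is the tail of [|X|] and [F (D * ...)] the tail of [|a_{ni} X|] at a
   fixed level, with [k = n - i]. *)
Definition rowsum D (n : nat) : R :=
  \sum_(1 <= k < n) F (D * (n%:R `^ (p + beta) * k%:R `^ (- beta))).

(** The exponent [m r - j] adds up [m] for the number of [n] in the block, [m (r - 2)] for the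
    weight and [m - j] for the number of [k]. *)
Definition diag D (m j : nat) : R :=
  tw (m%:R * r - j%:R) * F (D * tw (m%:R * p + j%:R * beta)).

Lemma rowsum_ge0 D n : 0 <= rowsum D n. Proof. exact: sumr_ge0. Qed.

Lemma diag_ge0 D m j : 0 <= diag D m j.
Proof. by rewrite mulr_ge0 ?tw_ge0. Qed.

(** [block_powR] is used once for [n] and once for [k]; the losses are collected in the factor
    inside [F]. Reversing the blocks of [k] makes [j] the distance to the top block. *)
Lemma rowsum_block_le D m n : 0 < D -> (2 ^ m <= n < 2 ^ m.+1)%N ->
  rowsum D n <= \sum_(0 <= j < m.+1)
    tw (m%:R - j%:R) * F (D * tw (- (`|p + beta| + `|beta|)) * tw (m%:R * p + j%:R * beta)).
Proof.
move=> D0 hn; have /andP[hn1 _] := block_powR (p + beta) hn.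
have /andP[n1 n2] := hn.
apply: (@le_trans _ _ (\sum_(1 <= k < 2 ^ m.+1)
    F (D * (n%:R `^ (p + beta) * k%:R `^ (- beta))))).
  rewrite [X in _ <= X](@big_cat_nat _ _ _ n)/= ?(ltnW n2)//.
    by rewrite lerDl sumr_ge0.
  by rewrite (leq_trans _ n1)// expn_gt0.
rewrite sum_dyadic big_nat_rev/=; apply: ler_sum_nat => j /andP[_ jm].
rewrite add0n subSS.
apply: le_trans (sum_block_le (c := F (D * tw (- (`|p + beta| + `|beta|)) * tw (m%:R * p + j%:R * beta))) _) _.
  move=> k hk; have /andP[hk1 _] := block_powR (- beta) hk.
  apply: Fanti; rewrite -!mulrA ler_pM2l//.
  apply: le_trans (ler_pM (tw_ge0 _) (tw_ge0 _) hn1 hk1).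
  rewrite -!twD tw_le// normrN natrB; last by rewrite -ltnS.
  by lra.
by rewrite natrB// -ltnS.
Qed.

(** At [n = 2 ^ m] the power of [n] is exact and the [k < n] fill only the blocks below [m], so the
    distances start at 1. *)
Lemma rowsum_pow2_ge D m : 0 < D ->
  \sum_(0 <= j < m) tw (m%:R - j.+1%:R) * F (D * tw `|beta| * tw (m%:R * p + j.+1%:R * beta))
  <= rowsum D (2 ^ m).
Proof.
move=> D0; rewrite /rowsum sum_dyadic [X in _ <= X]big_nat_rev/=.
apply: ler_sum_nat => j /andP[_ jm]; rewrite add0n.
apply: le_trans (sum_block_ge (c := F (D * tw `|beta| * tw (m%:R * p + j.+1%:R * beta))) _).
  by rewrite natrB.
move=> k hk; have /andP[_ hk2] := block_powR (- beta) hk.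
apply: Fanti; rewrite -!mulrA ler_pM2l//.
apply: le_trans (ler_wpM2l (powR_ge0 _ _) hk2) _.
rewrite -twn -twM -!twD tw_le// normrN natrB//.
by lra.
Qed.

Lemma rowsum_mono D m n : 0 <= p + beta -> 0 < D -> (2 ^ m <= n < 2 ^ m.+1)%N ->
  rowsum (D * tw (p + beta)) (2 ^ m) <= rowsum D n.
Proof.
move=> pb D0 hn; have /andP[n1 n2] := hn.
rewrite /rowsum [X in _ <= X](@big_cat_nat _ _ _ (2 ^ m))/= ?expn_gt0//.
apply: ler_wpDr; first exact: sumr_ge0.
apply: ler_sum_nat => k _; apply: Fanti; rewrite -!mulrA ler_pM2l//.
rewrite mulrA ler_wpM2r ?powR_ge0//.
have /andP[_ h] := block_powR (p + beta) hn; apply: le_trans h _.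
by rewrite -twn -twM -twD tw_le// ger0_norm//; lra.
Qed.

Definition weighted D (w : nat -> R) (s : nat) : R := w s * F (D * tw (s%:R * p)).

Lemma diag_bsum_rowsum :
  (forall D, 0 < D -> bsum (fun m => \sum_(0 <= j < m.+1) diag D m j)) ->
  forall D, 0 < D -> bsum (fun n => n%:R `^ (r - 2) * rowsum D n).
Proof.
move=> h D D0; pose D' := D * tw (- (`|p + beta| + `|beta|)).
have D'0 : 0 < D' by rewrite mulr_gt0 ?tw_gt0.
pose v m := tw `|r - 2| * \sum_(0 <= j < m.+1) diag D' m j.
apply: (@bsum_condense _ _ v).
- by move=> n; rewrite mulr_ge0 ?powR_ge0 ?rowsum_ge0.
- by rewrite /rowsum big_geq// mulr0.
- move=> m; apply: le_trans (sum_block_le (c := tw (m%:R * (r - 2) + `|r - 2|) *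
    \sum_(0 <= j < m.+1) tw (m%:R - j%:R) * F (D' * tw (m%:R * p + j%:R * beta))) _) _.
    move=> n hn; apply: ler_pM; rewrite ?powR_ge0 ?rowsum_ge0//.
      by have /andP[] := block_powR (r - 2) hn.
    exact: rowsum_block_le.
  rewrite mulrA -twD /v !mulr_sumr; apply: ler_sum => j _.
  rewrite /diag !mulrA ler_wpM2r// -!twD tw_le//; lra.
- by apply: (bsum_le (tw_ge0 `|r - 2|)) (h _ D'0).
Qed.

(* The shift [m = s + c j] turns the argument [2^(m p + j beta)] into a bound by [2^(s p)]. *)
Lemma weighted_bsum_diag D (c : nat -> nat) (w : nat -> R) C : 0 < D -> 0 <= C ->
  0 <= p ->
  (forall j, (c j <= j)%N) -> (forall j, - (j%:R * beta) <= (c j)%:R * p) ->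
  (forall M s, \sum_(0 <= j < M | (j <= s + c j)%N) tw ((s + c j)%:R * r - j%:R) <= C * w s) ->
  bsum (weighted D w) -> bsum (fun m => \sum_(0 <= j < m.+1) diag D m j).
Proof.
move=> D0 C0 p0 cj cb hw [B hB]; exists (C * B) => M.
apply: le_trans (ler_wpM2l C0 (hB M)).
have -> : \sum_(0 <= m < M) \sum_(0 <= j < m.+1) diag D m j =
   \sum_(0 <= j < M) \sum_(0 <= m < M | (j <= m)%N) diag D m j.
  rewrite (@exchange_big_dep_nat _ _ _ _ _ _ _ _ _ predT)//= big_nat_cond [RHS]big_nat_cond.
  apply: eq_bigr => m /andP[/andP[_ mM] _].
  by rewrite (@big_nat_widen _ _ _ _ _ M).
apply: (@le_trans _ _ (\sum_(0 <= j < M) \sum_(0 <= s < M | (j <= s + c j)%N)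
   tw ((s + c j)%:R * r - j%:R) * F (D * tw (s%:R * p)))).
  apply: ler_sum_nat => j /andP[_ jM].
  (* Since [c j <= j], no [m < c j] satisfies [j <= m]: this part of the sum is empty and
     [m = s + c j] may be substituted. *)
  rewrite (@big_cat_nat _ _ _ (c j) 0 M)/=; [|by []|exact: leq_trans (cj j) (ltnW jM)].
  rewrite [X in X + _]big_nat_cond [X in X + _]big1 ?add0r; last first.
    by move=> m /andP[/andP[_ h1] h2]; move: (cj j); lia.
  rewrite -{1}[c j]add0n big_addn.
  rewrite [X in _ <= X](@big_cat_nat _ _ _ (M - c j))/= ?leq_subr//.
  apply: ler_wpDr; first by apply: sumr_ge0 => s _; rewrite mulr_ge0 ?tw_ge0.
  apply: ler_sum => s hs; rewrite /diag ler_wpM2l ?tw_ge0//.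
  apply: Fanti; rewrite ler_pM2l// tw_le//.
  by rewrite natrD; move: (cb j); lra.
rewrite (@exchange_big_dep_nat _ _ _ _ _ _ _ _ _ predT)//= mulr_sumr.
by apply: ler_sum => s _; rewrite -mulr_suml /weighted mulrA ler_wpM2r.
Qed.

(** For a suitable [D], a lower bound of the terms of (ii): [1 - expR (- x)] bounds from below the
    capacity of a union of independent events whose capacities sum to [x]. *)
Definition ydecay D (n : nat) : R := n%:R `^ (r - 2) * (1 - expR (- rowsum D n)).

Lemma onemexp_ge x : 0 <= x -> 0 <= 1 - expR (- x) :> R.
Proof. by move=> x0; rewrite subr_ge0 -[X in _ <= X]expR0 ler_expR oppr_le0. Qed.

(** From [1 + x <= expR x] one gets [x * expR (- x) <= 1 - expR (- x)], and here
    [expR (- x) >= 1 / 2]. *)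
Lemma onemexp_lin x : 0 <= x -> 1 - expR (- x) <= 1 / 2 -> x <= 2 * (1 - expR (- x)) :> R.
Proof.
move=> x0 h; have := expR_ge1Dx x.
have e0 : 0 < expR x by exact: expR_gt0.
move: h; rewrite expRN; set e := expR x in e0 *.
have ee : e * e^-1 = 1 by rewrite divff// gt_eqF.
have e1 : 0 < e^-1 by rewrite invr_gt0.
set f := e^-1 in ee e1 * => h1 h2.
have : (1 + x) * f <= e * f by rewrite ler_wpM2r// ltW.
rewrite ee.
nra.
Qed.

(** The summable terms [y m] are bounded while their weight [2 ^ (m (r - 1))] tends to infinity; so
    [1 - expR (- g m)] is eventually at most 1/2 and comparable to [g m]. *)
Lemma decay_bsum_diag : 1 < r -> 0 <= p + beta ->
  (forall D, 0 < D -> bsum (ydecay D)) ->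
  forall D, 0 < D -> bsum (fun m => \sum_(0 <= j < m) diag D m j.+1).
Proof.
(* [D'] absorbs the loss of [rowsum_pow2_ge], and [D''] that of [rowsum_mono] in passing from all
   [n] of a block to [2 ^ m]. *)
move=> r1 pb h D D0; pose D' := D * tw (- `|beta|); pose D'' := D' * tw (- (p + beta)).
have D'0 : 0 < D' by rewrite mulr_gt0 ?tw_gt0.
have D''0 : 0 < D'' by rewrite mulr_gt0 ?tw_gt0.
pose g m := rowsum D' (2 ^ m).
have g0 m : 0 <= g m by exact: rowsum_ge0.
pose y m := tw (m%:R * (r - 1)) * (1 - expR (- g m)).
have y0 m : 0 <= y m by rewrite mulr_ge0 ?tw_ge0 ?onemexp_ge.
have by_ : bsum y.
  have b1 : bsum (fun m => tw (- `|r - 2|) * y m).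
    apply: bsum_blocks (h _ D''0).
      by move=> n; rewrite mulr_ge0 ?powR_ge0 ?onemexp_ge ?rowsum_ge0.
    move=> m; apply: le_trans (sum_block_ge (c := tw (m%:R * (r - 2) - `|r - 2|) * (1 - expR (- g m))) _).
      by rewrite /y !mulrA ler_wpM2r ?onemexp_ge// -!twD tw_le//; lra.
    move=> n hn; apply: ler_pM; [exact: tw_ge0|exact: onemexp_ge| |].
      by have /andP[] := block_powR (r - 2) hn.
    rewrite lerD2l lerN2 ler_expR lerN2 /g.
    suff -> : D' = D'' * tw (p + beta) by exact: rowsum_mono.
    by rewrite /D'' -mulrA -twD addNr tw0 mulr1.
  apply: (@bsum_le _ (tw `|r - 2|)) b1; first exact: tw_ge0.
  by move=> m; rewrite mulrA -twD subrr tw0 mul1r.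
have [B [B0 hB]] := bsum_bounded y0 by_.
have b2 : bsum (fun m => tw (m%:R * (r - 1)) * g m).
  (* From [N0] on, the linear bound [tw_ge_lin] already gives [2 * B <= 2 ^ (m (r - 1))]. *)
  pose N0 := (Num.truncn (2 * B / ((r - 1) * ln 2))).+1.
  apply: (@bsum_eventually _ N0 2) by_ => // m mN; rewrite /y mulrCA ler_wpM2l ?tw_ge0//.
  apply: onemexp_lin => //.
  have hm : 2 * B <= m%:R * (r - 1) * ln 2.
    rewrite -mulrA -ler_pdivrMr ?mulr_gt0 ?subr_gt0 ?ln_gt0 ?ltr1n// ltW//; apply: lt_le_trans (truncnS_gt _) _.
    by rewrite ler_nat.
  have h1 := hB m; rewrite /y in h1.
  have h2 : 2 * B <= tw (m%:R * (r - 1)).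
    exact: le_trans hm (tw_ge_lin _).
  have := onemexp_ge (g0 m); set z := 1 - _ in h1 *.
  nra.
apply: (@bsum_le _ 1) b2 => // m; rewrite mul1r.
apply: le_trans (ler_wpM2l (tw_ge0 _) (rowsum_pow2_ge m D'0)).
rewrite mulr_sumr; apply: ler_sum_nat => j _; rewrite /diag mulrA -twD.
have -> : D' * tw `|beta| = D by rewrite /D' -mulrA -twD addNr tw0 mulr1.
by rewrite ler_wpM2r// tw_le//; lra.
Qed.

(** Counterpart of [weighted_bsum_diag]: [d] is rounded down, so that [2 ^ (m p + j beta)] with
    [m = s + d j] stays below [2 ^ (s p)]. The pairs [(s + d j, j)] are distinct, hence their terms
    are part of the convergent double sum. *)
Lemma diag_bsum_weighted D (d J : nat -> nat) (w : nat -> R) C : 0 < D -> 0 <= C -> 0 <= p ->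
  (forall j, (d j <= j)%N) -> (forall j, (d j)%:R * p <= - (j%:R * beta)) ->
  (forall s, w s <= C * \sum_(1 <= j < J s | (j <= s + d j)%N) tw ((s + d j)%:R * r - j%:R)) ->
  bsum (fun m => \sum_(0 <= j < m) diag D m j.+1) -> bsum (weighted D w).
Proof.
move=> D0 C0 p0 dj db hw [B hB]; exists (C * B) => S.
(* A common bound of [J s] for [s < S] makes the range of [j] independent of [s] before the sums are
   exchanged. *)
pose Jm := (\sum_(0 <= s < S) J s).+1.
have JJ s : (s < S)%N -> (J s <= Jm)%N.
  move=> sS; rewrite /Jm (big_cat_nat (leq0n s) (ltnW sS))/= (big_ltn sS).
  by lia.
apply: le_trans (ler_wpM2l C0 (hB (S + Jm)%N)).
apply: (@le_trans _ _ (C * \sum_(0 <= s < S) \sum_(1 <= j < Jm | (j <= s + d j)%N)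
   diag D (s + d j) j)).
  rewrite mulr_sumr; apply: ler_sum_nat => s /andP[_ sS].
  apply: le_trans (ler_wpM2r (F0 _) (hw s)) _.
  rewrite -mulrA ler_wpM2l// mulr_suml.
  have [J1|J1] := leqP (J s) 1; first by rewrite big_geq// sumr_ge0// => j _; exact: diag_ge0.
  rewrite [X in _ <= X](@big_cat_nat _ _ _ (J s))/= ?JJ ?(ltnW J1)//.
  apply: ler_wpDr; first by apply: sumr_ge0 => j _; exact: diag_ge0.
  apply: ler_sum => j hj; rewrite /diag ler_wpM2l ?tw_ge0//.
  apply: Fanti; rewrite ler_pM2l// tw_le//.
  by rewrite natrD; move: (db j); lra.
rewrite ler_wpM2l// (@exchange_big_dep_nat _ _ _ _ _ _ _ _ _ predT)//=.
apply: (@le_trans _ _ (\sum_(1 <= j < Jm) \sum_(0 <= m < S + Jm | (j <= m)%N) diag D m j)).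
  apply: ler_sum_nat => j /andP[_ jJ].
  rewrite [X in _ <= X](@big_cat_nat _ _ _ (d j))/=; [|by []|by move: (dj j); lia].
  apply: ler_wpDl; first by apply: sumr_ge0 => m _; exact: diag_ge0.
  rewrite [X in _ <= X](_ : _ = \sum_(0 + d j <= m < S + Jm | (j <= m)%N) diag D m j)//.
  rewrite big_addn.
  rewrite [X in _ <= X](@big_cat_nat _ _ _ S)/= ?lexx//; last by move: (dj j); lia.
  by apply: ler_wpDr => //; apply: sumr_ge0 => m _; exact: diag_ge0.
rewrite (@exchange_big_dep_nat _ _ _ _ _ _ _ _ _ predT)//=.
apply: ler_sum_nat => m /andP[_ mS].
have -> : \sum_(0 <= j < m) diag D m j.+1 = \sum_(1 <= j < m.+1) diag D m j.
  by rewrite big_add1.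
rewrite [X in _ <= X](@big_nat_widen _ _ _ _ _ (Jm + m.+1)%N) ?leq_addl//=.
rewrite [X in _ <= X](@big_cat_nat _ _ _ Jm)/= ?leq_addr//.
by apply: ler_wpDr => //; apply: sumr_ge0 => j _; exact: diag_ge0.
Qed.

End DyadicReduction.

(** * Sums along the shifted diagonals in the three regimes of beta *)

Section Regimes.
Set Implicit Arguments. Unset Strict Implicit. Unset Printing Implicit Defensive.
Context {R : realType} (F : R -> R).
Context (F0 : forall x, 0 <= F x).
Context (Fanti : forall x y, x <= y -> F y <= F x).
Context (p beta r : R) (p0 : 0 < p) (pb : 0 < p + beta) (r1 : 1 < r).
Implicit Types (D : R).

(** The three weights are, up to constants, the moment functions of (i) at [|X| = 2 ^ (s p)]. *)
Definition wlow (s : nat) : R := tw (s%:R * ((r - 1) * p / (p + beta))).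
Definition wcrit (s : nat) : R := tw (s%:R * r) * s.+1%:R.
Definition whigh (s : nat) : R := tw (s%:R * r).

(** For [beta >= 0] the factor [2 ^ (j beta)] is at least 1 and no shift is made, whence the maximum
    with 0; [p + beta > 0] gives [g < 1]. *)
Let g : R := Num.max (- beta / p) 0.
Let g0 : 0 <= g. Proof. by rewrite le_max lexx orbT. Qed.
Let g1 : g < 1.
Proof. by rewrite gt_max ltr01 andbT ltr_pdivrMr// mul1r; move: pb; lra. Qed.
Let gp : - beta <= g * p.
Proof. by rewrite -ler_pdivrMr// le_max lexx. Qed.
Let gE : beta < 0 -> g * p = - beta.
Proof.
move=> b0; rewrite /g max_l ?divfK ?gt_eqF//.
by rewrite divr_ge0 ?oppr_ge0// ltW.
Qed.

(** [j g] is rounded up for upper bounds and down for lower ones. As [g < 1], capping [c] at [j]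
    keeps [j g <= c j] while ensuring [c j <= j]. *)
Let c (j : nat) := minn j (Num.truncn (j%:R * g)).+1.
Let d (j : nat) := Num.truncn (j%:R * g).

Let jg0 (j : nat) : 0 <= j%:R * g. Proof. by rewrite mulr_ge0. Qed.
Let d_le (j : nat) : (d j)%:R <= j%:R * g.
Proof. by rewrite /d truncn_le. Qed.
Let d_ge (j : nat) : j%:R * g - 1 <= (d j)%:R.
Proof.
have := truncnS_gt (j%:R * g); rewrite -/(d j) -nat1r => h.
by rewrite lerBlDl ltW.
Qed.
Let dj (j : nat) : (d j <= j)%N.
Proof.
rewrite -(ler_nat R); apply: le_trans (d_le j) _.
by rewrite ler_piMr// ltW.
Qed.
Let cj (j : nat) : (c j <= j)%N. Proof. exact: geq_minl. Qed.
Let c_ge (j : nat) : j%:R * g <= (c j)%:R.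
Proof.
rewrite /c /minn; case: ifP => _; first by rewrite ler_piMr// ltW.
exact: ltW (truncnS_gt _).
Qed.
Let c_le (j : nat) : (c j)%:R <= j%:R * g + 1.
Proof.
apply: (@le_trans _ _ (d j).+1%:R); first by rewrite ler_nat geq_minr.
by rewrite -nat1r addrC lerD2r d_le.
Qed.
Let cb (j : nat) : - (j%:R * beta) <= (c j)%:R * p.
Proof.
apply: (@le_trans _ _ (j%:R * g * p)); last by rewrite ler_wpM2r ?c_ge// ltW.
by rewrite -mulrN -mulrA ler_wpM2l.
Qed.
Let db (b0 : beta < 0) (j : nat) : (d j)%:R * p <= - (j%:R * beta).
Proof.
apply: (@le_trans _ _ (j%:R * g * p)); first by rewrite ler_wpM2r ?d_le// ltW.
by rewrite -mulrA gE// mulrN.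
Qed.

Let r_ge0 : 0 <= r. Proof. exact: ltW (lt_trans ltr01 r1). Qed.
Let th : R := g * r - 1.
Let r_gt0 : 0 < r. Proof. exact: lt_trans ltr01 r1. Qed.
Let th_crit : beta = - p / r -> th = 0.
Proof.
move=> hb; have b0 : beta < 0 by rewrite hb mulNr oppr_lt0 divr_gt0.
have gr : g * p * r = p by rewrite gE// hb; field; rewrite gt_eqF.
apply/eqP; rewrite subr_eq0; apply/eqP.
by apply: (mulIf (lt0r_neq0 p0)); rewrite mul1r -mulrA [r * p]mulrC mulrA.
Qed.
Let th_low : beta < - p / r -> 0 < th.
Proof.
move=> hb; have b0 : beta < 0 by apply: lt_trans hb _; rewrite mulNr oppr_lt0 divr_gt0.
rewrite subr_gt0 -(ltr_pM2r p0) mul1r mulrAC gE// -ltr_pdivrMr// ltrNr -mulNr.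
exact: hb.
Qed.
(** When [th > 0] the last index [j = s / (1 - g)] dominates; this identity shows that its term has
    the order of [wlow s]. *)
Let th_exponent : beta < 0 -> r + th / (1 - g) = (r - 1) * p / (p + beta).
Proof.
move=> b0; have -> : beta = - (g * p) by rewrite gE// opprK.
have g1' : 1 - g != 0 by rewrite gt_eqF ?subr_gt0.
rewrite /th; field.
have -> : p - g * p = p * (1 - g) by ring.
by rewrite mulf_eq0 negb_or (lt0r_neq0 p0) g1'.
Qed.
Let term_le (s j : nat) : tw ((s + c j)%:R * r - j%:R) <= tw r * (whigh s * tw (j%:R * th)).
Proof.
rewrite /whigh -!twD tw_le// natrD /th.
have : (c j)%:R * r <= (j%:R * g + 1) * r by rewrite ler_wpM2r.
lra.
Qed.
Let term_ge (s j : nat) : tw (- r) * (whigh s * tw (j%:R * th)) <= tw ((s + d j)%:R * r - j%:R).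
Proof.
rewrite /whigh -!twD tw_le// natrD /th.
have : (j%:R * g - 1) * r <= (d j)%:R * r by rewrite ler_wpM2r.
lra.
Qed.
Let range (s j : nat) : (j <= s + c j)%N -> (j < (Num.truncn ((s.+1)%:R / (1 - g))).+1)%N.
Proof.
rewrite -(ler_nat R) natrD => h; rewrite ltnS truncn_ge_nat; last first.
  by rewrite divr_ge0// subr_ge0 ltW.
rewrite ler_pdivlMr ?subr_gt0//; move: (c_le j) h; rewrite -nat1r; lra.
Qed.

Lemma sum_range_le (P : pred nat) M N (u : nat -> R) : (forall j, 0 <= u j) ->
  (forall j, P j -> (j < N)%N) ->
  \sum_(0 <= j < M | P j) u j <= \sum_(0 <= j < N) u j.
Proof.
move=> u0 PN; rewrite [X in _ <= X](@big_nat_widen _ _ _ _ _ (M + N)%N) ?leq_addl//=.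
rewrite [X in _ <= X](@big_cat_nat _ _ _ M)/= ?leq_addr//.
apply: ler_wpDr; first exact: sumr_ge0.
rewrite big_mkcond [X in _ <= X]big_mkcond/=; apply: ler_sum => j _.
by case: ifPn => [/PN ->//|_]; case: ifP.
Qed.

Let up D w C : 0 < D -> 0 <= C ->
  (forall M s, \sum_(0 <= j < M | (j <= s + c j)%N) tw (j%:R * th) * whigh s <= C * w s) ->
  bsum (weighted F p D w) -> bsum (fun m => \sum_(0 <= j < m.+1) diag F p beta r D m j).
Proof.
move=> D0 C0 hw; apply: (weighted_bsum_diag F0 Fanti (c := c) (C := tw r * C)) => //.
- by rewrite mulr_ge0 ?tw_ge0.
- exact: ltW.
- move=> M s; rewrite -mulrA; apply: le_trans (ler_wpM2l (tw_ge0 _) (hw M s)).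
  rewrite mulr_sumr; apply: ler_sum => j _; rewrite [tw _ * whigh _]mulrC.
  exact: term_le.
Qed.

Lemma whigh_rowsum : - p / r < beta -> (forall D, 0 < D -> bsum (weighted F p D whigh)) ->
  forall D, 0 < D -> bsum (fun n => n%:R `^ (r - 2) * rowsum F p beta D n).
Proof.
move=> hb h; apply: (diag_bsum_rowsum F0 Fanti) => D D0.
have r0 : 0 < r by apply: lt_trans r1.
have th0 : th < 0.
  rewrite subr_lt0 -ltr_pdivlMr// gt_max divr_gt0// andbT.
  by rewrite ltr_pdivrMr//; move: hb; rewrite mulNr mul1r [r^-1 * p]mulrC; lra.
(* [th < 0]: the constant is the full geometric series in [j]. *)
apply: (@up D whigh (1 - tw th)^-1 D0); last exact: h.
  by rewrite invr_ge0 subr_ge0 ltW// tw_lt1.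
move=> M s; rewrite -mulr_suml ler_wpM2r ?tw_ge0//.
apply: (@le_trans _ _ (\sum_(0 <= j < M) tw (j%:R * th))).
  by rewrite big_mkcond/=; apply: ler_sum => j _; case: ifP => // _; exact: tw_ge0.
under eq_bigr do rewrite twMn.
by apply: sum_geo_le; [exact: tw_ge0|exact: tw_lt1].
Qed.

Lemma wcrit_rowsum : beta = - p / r -> (forall D, 0 < D -> bsum (weighted F p D wcrit)) ->
  forall D, 0 < D -> bsum (fun n => n%:R `^ (r - 2) * rowsum F p beta D n).
Proof.
move=> hb h; apply: (diag_bsum_rowsum F0 Fanti) => D D0.
have r0 : 0 < r by apply: lt_trans r1.
have b0 : beta < 0 by rewrite hb mulNr oppr_lt0 divr_gt0.
have th0 := th_crit hb.
have ig : 0 <= (1 - g)^-1 by rewrite invr_ge0 subr_ge0 ltW.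
(* [th = 0]: every term is 1, and there are at most [(s + 1) / (1 - g) + 1] of them. *)
apply: (@up D wcrit ((1 - g)^-1 + 1) D0); last exact: h.
  by rewrite addr_ge0.
move=> M s; rewrite -mulr_suml /wcrit -/(whigh s) mulrC mulrCA ler_wpM2l ?tw_ge0//.
apply: le_trans (@sum_range_le _ M _ _ _ (@range s)) _; first by move=> j; exact: tw_ge0.
under eq_bigr do rewrite th0 mulr0 tw0.
rewrite sumr_const_nat subn0.
have hN : (Num.truncn (s.+1%:R / (1 - g)))%:R <= s.+1%:R / (1 - g).
  by rewrite truncn_le divr_ge0// subr_ge0 ltW.
have : (1 : R) <= s.+1%:R by rewrite ler1n.
by rewrite -[(Num.truncn _).+1%:R]natr1; move: hN; lra.
Qed.

Lemma wlow_rowsum : beta < - p / r -> (forall D, 0 < D -> bsum (weighted F p D wlow)) ->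
  forall D, 0 < D -> bsum (fun n => n%:R `^ (r - 2) * rowsum F p beta D n).
Proof.
move=> hb h; apply: (diag_bsum_rowsum F0 Fanti) => D D0.
have r0 : 0 < r by apply: lt_trans r1.
have b0 : beta < 0 by apply: lt_trans hb _; rewrite mulNr oppr_lt0 divr_gt0.
have th0 := th_low hb.
have nt1 : tw (- th) < 1 by rewrite tw_lt1 ?oppr_lt0.
have ig : 0 <= (1 - tw (- th))^-1 by rewrite invr_ge0 subr_ge0 ltW.
have ex := th_exponent b0.
apply: (@up D wlow ((1 - tw (- th))^-1 * tw (th / (1 - g))) D0); last exact: h.
  by rewrite mulr_ge0 ?tw_ge0.
move=> M s; rewrite -mulr_suml.
set N := Num.truncn (s.+1%:R / (1 - g)).
have hN : N%:R <= s.+1%:R / (1 - g).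
  by rewrite /N truncn_le divr_ge0// subr_ge0 ltW.
apply: (@le_trans _ _ ((1 - tw (- th))^-1 * tw (N%:R * th) * whigh s)).
  rewrite ler_wpM2r ?tw_ge0//.
  apply: le_trans (@sum_range_le _ M _ _ _ (@range s)) _; first by move=> j; exact: tw_ge0.
  (* [th > 0]: read backwards, the sum is at most its last term times a geometric series of ratio
     [tw (- th)]. *)
  rewrite big_nat_rev/=; apply: le_trans (ler_wpM2r (tw_ge0 _) (sum_geo_le N.+1 (tw_ge0 _) nt1)).
  rewrite mulr_suml; apply: ler_sum_nat => j /andP[_ jN].
  rewrite -twMn -twD tw_le// add0n subSS natrB ?natrD//.
  by lra.
rewrite -!mulrA ler_wpM2l// -!twD tw_le// /whigh -ex.
have : N%:R * th <= s.+1%:R / (1 - g) * th by rewrite ler_wpM2r// ltW.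
rewrite -nat1r mulrDl mul1r; lra.
Qed.

Let down w C (J : nat -> nat) : beta < 0 -> 0 <= C ->
  (forall s, (0 < s)%N -> w s <= C * \sum_(1 <= j < J s | (j <= s + d j)%N) (tw (- r) * (whigh s * tw (j%:R * th)))) ->
  (forall s, 0 <= w s) ->
  (forall D, 0 < D -> bsum (ydecay F p beta r D)) ->
  forall D, 0 < D -> bsum (weighted F p D w).
Proof.
move=> b0 C0 hw w0 h D D0.
have h1 := decay_bsum_diag F0 Fanti r1 (ltW pb) h D0.
(* At [s = 0] no [j >= 1] satisfies [j <= d j], so this term is left out of the comparison. *)
pose w' s := if s is 0 then 0 else w s.
apply: (@bsum_eventually _ 1 1 _ (weighted F p D w')) => //.
- by case=> [|n]; rewrite /weighted /= ?mul0r// mulr_ge0.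
- by case=> // n _; rewrite mul1r.
apply: (diag_bsum_weighted F0 Fanti (d := d) (J := J) (C := C)) h1 => //.
- exact: ltW.
- exact: db.
- case=> [|s] /=; first by rewrite mulr_ge0// sumr_ge0// => j _; exact: tw_ge0.
  apply: le_trans (hw s.+1 isT) _; rewrite ler_wpM2l//.
  by apply: ler_sum => j _; exact: term_ge.
Qed.

(** The diagonal [j = 1] alone suffices, in every regime; replacing [D] by [D * tw (- beta)] undoes
    the factor [2 ^ beta] in its argument. *)
Lemma decay_whigh : (forall D, 0 < D -> bsum (ydecay F p beta r D)) ->
  forall D, 0 < D -> bsum (weighted F p D whigh).
Proof.
move=> h D D0; have D'0 : 0 < D * tw (- beta) by rewrite mulr_gt0 ?tw_gt0.
apply: (@bsum_eventually _ 1 (tw 1)) (decay_bsum_diag F0 Fanti r1 (ltW pb) h D'0).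
- exact: tw_ge0.
- by move=> n; apply: sumr_ge0 => j _; exact: diag_ge0.
case=> // m _; rewrite big_ltn// mulrDr.
apply: ler_wpDr; first by rewrite mulr_ge0 ?tw_ge0// sumr_ge0// => j _; exact: diag_ge0.
rewrite /weighted /diag mulrA -twD /whigh -mulrA -twD.
have -> : - beta + (m.+1%:R * p + 1 * beta) = m.+1%:R * p by ring.
by rewrite ler_wpM2r// tw_le//; lra.
Qed.

Lemma decay_wcrit : beta = - p / r -> (forall D, 0 < D -> bsum (ydecay F p beta r D)) ->
  forall D, 0 < D -> bsum (weighted F p D wcrit).
Proof.
move=> hb; have r0 : 0 < r by apply: lt_trans r1.
have b0 : beta < 0 by rewrite hb mulNr oppr_lt0 divr_gt0.
have th0 := th_crit hb.
(* All [j] from 1 to [s] are admissible and contribute equally; the 2 compares their number [s] with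
   [s + 1]. *)
apply: (@down wcrit (2 * tw r) (fun s => s.+1)) => //.
- by rewrite mulr_ge0 ?tw_ge0.
- move=> s s0; rewrite (eq_bigr (fun=> tw (- r) * whigh s)); last first.
    by move=> j _; rewrite th0 mulr0 tw0 mulr1.
  rewrite big_nat_cond (eq_bigl (fun j => (1 <= j < s.+1)%N)); last first.
    move=> j; case: (boolP (1 <= j < s.+1)%N) => //= /andP[_ js].
    by rewrite -ltnS (leq_trans js)// ltnS leq_addr.
  rewrite -big_nat sumr_const_nat subSS subn0 /wcrit -/(whigh s).
  have -> : 2 * tw r * (tw (- r) * whigh s *+ s) =
    (tw r * tw (- r)) * (whigh s * (2 * s%:R)) by ring.
  rewrite -twD subrr tw0 mul1r ler_wpM2l ?tw_ge0//.
  by rewrite -natrM ler_nat; lia.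
- by move=> s; rewrite mulr_ge0 ?tw_ge0.
Qed.

Lemma decay_wlow : beta < - p / r -> (forall D, 0 < D -> bsum (ydecay F p beta r D)) ->
  forall D, 0 < D -> bsum (weighted F p D wlow).
Proof.
move=> hb; have r0 : 0 < r by apply: lt_trans r1.
have b0 : beta < 0 by apply: lt_trans hb _; rewrite mulNr oppr_lt0 divr_gt0.
have th0 := th_low hb.
have ex := th_exponent b0.
(* The largest admissible [j], the only one kept: as the last of a growing geometric series, it has
   the order of the whole sum. *)
pose N (s : nat) := Num.truncn (s%:R / (1 - g)).
have sg0 (s : nat) : 0 <= s%:R / (1 - g) by rewrite divr_ge0// subr_ge0 ltW.
have sN s : (s <= N s)%N.
  rewrite /N truncn_ge_nat// ler_pdivlMr ?subr_gt0// ler_piMr//.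
  by rewrite gerBl.
apply: (@down wlow (tw (r + th)) (fun s => (N s).+1)) => //; first exact: tw_ge0.
  move=> s s0; rewrite big_mkcond big_nat_recr/= ?(leq_trans s0)//.
  have -> : (N s <= s + d (N s))%N.
    rewrite -leq_subLR /d truncn_ge_nat// natrB//.
    have : (N s)%:R <= s%:R / (1 - g) by rewrite truncn_le.
    by rewrite ler_pdivlMr ?subr_gt0//; lra.
  rewrite mulrDr; apply: ler_wpDl.
    rewrite mulr_ge0 ?tw_ge0// sumr_ge0// => j _; case: ifP => // _.
    by rewrite !mulr_ge0 ?tw_ge0.
  rewrite /whigh -!twD /wlow tw_le// -ex.
  have : (s%:R / (1 - g) - 1) * th <= (N s)%:R * th.
    rewrite ler_wpM2r ?(ltW th0)//.
    by have := truncnS_gt (s%:R / (1 - g)); rewrite -/(N s) -nat1r; lra.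
  by lra.
by move=> s; exact: tw_ge0.
Qed.

End Regimes.

(** * Sublinear expectations and capacities *)

Section SublinearSpace.
Set Implicit Arguments. Unset Strict Implicit. Unset Printing Implicit Defensive.
Context {d : measure_display} {Omega : measurableType d} {R : realType}.
Context (H : set (Omega -> R)) (E : (Omega -> R) -> \bar R).
Context (hS : sublinear_space H E).
Implicit Types (X Y : Omega -> R) (A B : set Omega).

Lemma H_measurable X : H X -> measurable_fun setT X.
Proof. by have [h _] := hS; exact: h. Qed.
Lemma H_indic A : measurable A -> H (\1_A).
Proof. by have [_ [h _]] := hS; exact: h. Qed.
Lemma H_locLip n (phi : ('I_n -> R) -> R) (Xv : 'I_n -> Omega -> R) :
  locLip phi -> (forall i, H (Xv i)) -> H (fun w => phi (fun i => Xv i w)).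
Proof. by have [_ [_ [h _]]] := hS; exact: h. Qed.
Lemma E_mono X Y : H X -> H Y -> (forall w, X w <= Y w) -> (E X <= E Y)%E.
Proof. by have [_ [_ [_ [h _]]]] := hS; exact: h. Qed.
Lemma E_cst (c : R) : E (fun=> c) = c%:E.
Proof. by have [_ [_ [_ [_ [h _]]]]] := hS; exact: h. Qed.
Lemma E_scale X (l : R) : H X -> 0 <= l -> E (fun w => l * X w) = (l%:E * E X)%E.
Proof. by have [_ [_ [_ [_ [_ [h _]]]]]] := hS; exact: h. Qed.
Lemma E_subadd X Y : H X -> H Y ->
  ~ (E X = +oo%E /\ E Y = -oo%E) -> ~ (E X = -oo%E /\ E Y = +oo%E) ->
  (E (fun w => (X w + Y w)%R) <= E X + E Y)%E.
Proof. by have [_ [_ [_ [_ [_ [_ [h _]]]]]]] := hS; exact: h. Qed.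
Lemma E_countable X (Xn : nat -> Omega -> R) : H X -> (forall k, H (Xn k)) ->
  (forall w, 0 <= X w) -> (forall k w, 0 <= Xn k w) ->
  (forall w, ((X w)%:E <= \sum_(0 <= k <oo) (Xn k w)%:E)%E) ->
  (E X <= \sum_(0 <= k <oo) E (Xn k))%E.
Proof. by have [_ [_ [_ [_ [_ [_ [_ h]]]]]]] := hS; exact: h. Qed.

Lemma H_binary (phi : R -> R -> R) X Y :
  (forall a b a' b', `|phi a b - phi a' b'| <=
     (1 + (`|a| + `|b|) + (`|a'| + `|b'|)) * (`|a - a'| + `|b - b'|)) ->
  H X -> H Y -> H (fun w => phi (X w) (Y w)).
Proof.
move=> hphi HX HY.
pose Xv (i : 'I_2) : Omega -> R := if i == ord0 then X else Y.
apply: (@H_locLip 2 (fun x => phi (x ord0) (x (lift ord0 ord0))) Xv).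
  exists 1, 1%N; split => // x y.
  by rewrite mul1r !expr1 /nrm1 !big_ord_recl !big_ord0 !addr0; exact: hphi.
by move=> i; rewrite /Xv; case: ifP.
Qed.

Lemma H_cst (c : R) : H (fun=> c).
Proof.
apply: (@H_locLip 0 (fun=> c) (fun i => fun=> 0)); last by case.
by exists 0, 0%N; split => // x y; rewrite subrr normr0 !mul0r.
Qed.

Lemma H_add X Y : H X -> H Y -> H (fun w => X w + Y w).
Proof.
apply: H_binary => a b a' b'; rewrite opprD addrACA.
apply: le_trans (ler_normD _ _) _; rewrite ler_peMl ?addr_ge0//.
by rewrite -addrA lerDl !addr_ge0.
Qed.

Lemma H_mul X Y : H X -> H Y -> H (fun w => X w * Y w).
Proof.
apply: H_binary => a b a' b'.
have -> : a * b - a' * b' = (a - a') * b + a' * (b - b') by ring.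
apply: le_trans (ler_normD _ _) _; rewrite !normrM mulrDr.
apply: lerD; first by rewrite mulrC ler_wpM2r// -!addrA addrA addrCA lerDl !addr_ge0.
by rewrite ler_wpM2r// addrC -!addrA lerDl !addr_ge0.
Qed.

Lemma H_max X Y : H X -> H Y -> H (fun w => Num.max (X w) (Y w)).
Proof.
apply: H_binary => a b a' b'.
apply: (@le_trans _ _ (`|a - a'| + `|b - b'|)); last first.
  rewrite ler_peMl ?addr_ge0// -addrA lerDl !addr_ge0//.
have h1 := ler_norm (a - a'); have h2 := ler_norm (b - b').
have h3 := ler_norm (a' - a); have h4 := ler_norm (b' - b).
rewrite (distrC a') in h3; rewrite (distrC b') in h4.
have n1 := normr_ge0 (a - a'); have n2 := normr_ge0 (b - b').
rewrite ler_norml; case: (leP a b); case: (leP a' b'); lra.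
Qed.

Lemma H_scale (l : R) X : H X -> H (fun w => l * X w).
Proof. by move=> HX; apply: H_mul => //; exact: H_cst. Qed.

Lemma H_opp X : H X -> H (fun w => - X w).
Proof.
by move=> HX; have := H_scale (-1) HX; under eq_fun do rewrite mulN1r.
Qed.

Lemma H_min X Y : H X -> H Y -> H (fun w => Num.min (X w) (Y w)).
Proof.
move=> HX HY; have := H_opp (H_max (H_opp HX) (H_opp HY)).
by under eq_fun do rewrite oppr_max !opprK.
Qed.

Lemma H_norm X : H X -> H (fun w => `|X w|).
Proof.
move=> HX; have := H_max HX (H_opp HX).
by under eq_fun do rewrite maxrN.
Qed.

(** On bounded elements [E] is finite, so [Er] obeys the sublinear rules in [R] without exceptions
    for infinite values. *)
Definition bdH X := H X /\ exists M : R, forall w, `|X w| <= M.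

Lemma bdH_cst (c : R) : bdH (fun=> c).
Proof. by split; [exact: H_cst|exists `|c|]. Qed.
Lemma bdH_add X Y : bdH X -> bdH Y -> bdH (fun w => X w + Y w).
Proof.
move=> [HX [M hM]] [HY [N hN]]; split; first exact: H_add.
by exists (M + N) => w; apply: le_trans (ler_normD _ _) _; exact: lerD.
Qed.
Lemma bdH_mul X Y : bdH X -> bdH Y -> bdH (fun w => X w * Y w).
Proof.
move=> [HX [M hM]] [HY [N hN]]; split; first exact: H_mul.
by exists (M * N) => w; rewrite normrM ler_pM.
Qed.
Lemma bdH_scale (l : R) X : bdH X -> bdH (fun w => l * X w).
Proof. by move=> hX; apply: bdH_mul => //; exact: bdH_cst. Qed.
Lemma bdH_opp X : bdH X -> bdH (fun w => - X w).
Proof. by move=> [HX [M hM]]; split; [exact: H_opp|exists M => w; rewrite normrN]. Qed.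
Lemma bdH_indic A : measurable A -> bdH (\1_A).
Proof.
move=> mA; split; first exact: H_indic.
by exists 1 => w; rewrite indicE; case: (_ \in _); rewrite ?normr1 ?normr0.
Qed.

Definition Er X : R := fine (E X).

Lemma E_bdH X : bdH X -> E X = (Er X)%:E.
Proof.
move=> [HX [M hM]]; rewrite /Er fineK// fin_numElt; apply/andP; split.
  apply: (@lt_le_trans _ _ (E (fun=> - M))); first by rewrite E_cst ltNyr.
  apply: E_mono => //; first exact: H_cst.
  by move=> w; have := hM w; rewrite ler_norml => /andP[].
apply: (@le_lt_trans _ _ (E (fun=> M))); last by rewrite E_cst ltry.
apply: E_mono => //; first exact: H_cst.
by move=> w; exact: le_trans (ler_norm _) (hM w).
Qed.

Lemma Er_le X Y : bdH X -> bdH Y -> (forall w, X w <= Y w) -> Er X <= Er Y.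
Proof.
move=> bX bY XY; rewrite -lee_fin -!E_bdH//.
by apply: E_mono => //; [case: bX|case: bY].
Qed.
Lemma Er_cst (c : R) : Er (fun=> c) = c. Proof. by rewrite /Er E_cst. Qed.
Lemma Er_ge0 X : bdH X -> (forall w, 0 <= X w) -> 0 <= Er X.
Proof. by move=> bX X0; rewrite -[X in X <= _](Er_cst 0) Er_le//; exact: bdH_cst. Qed.
Lemma Er_add X Y : bdH X -> bdH Y -> Er (fun w => X w + Y w) <= Er X + Er Y.
Proof.
move=> bX bY; rewrite -lee_fin EFinD -!E_bdH//; last exact: bdH_add.
by apply: E_subadd; rewrite ?(E_bdH bX) ?(E_bdH bY); [case: bX|case: bY|case|case].
Qed.
Lemma Er_scale X (l : R) : bdH X -> 0 <= l -> Er (fun w => l * X w) = l * Er X.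
Proof. by move=> bX l0; rewrite /Er E_scale//; [rewrite (E_bdH bX)|case: bX]. Qed.
(** Sub-additivity for [c + X] gives one inequality, and for [- c + (c + X)] the other. *)
Lemma Er_translate X (c : R) : bdH X -> Er (fun w => c + X w) = c + Er X.
Proof.
move=> bX; have bc := bdH_cst c; apply/eqP; rewrite eq_le; apply/andP; split.
  by apply: le_trans (Er_add bc bX) _; rewrite Er_cst.
have := Er_add (bdH_cst (- c)) (bdH_add bc bX).
by under eq_fun do rewrite addKr; rewrite Er_cst; lra.
Qed.

Notation V := (capV H E).

Lemma capV_le_E A X : H X -> (forall w, \1_A w <= X w) -> (V A <= E X)%E.
Proof. by move=> HX AX; apply: ereal_inf_lbound; exists X. Qed.

Lemma capV_mono A B : A `<=` B -> (V A <= V B)%E.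
Proof.
move=> AB; apply: le_ereal_inf_tmp => _ [X [HX BX] <-].
apply: ereal_inf_lbound; exists X => //; split=> // w.
apply: le_trans (BX w); rewrite !indicE; case: (boolP (w \in A)) => [|_].
  by rewrite inE => /AB wB; rewrite mem_set.
by case: (_ \in _).
Qed.

Lemma capV_ge0 A : (0 <= V A)%E.
Proof.
apply: le_ereal_inf_tmp => _ [X [HX AX] <-].
apply: (@le_trans _ _ (E (fun=> 0))); first by rewrite E_cst.
apply: E_mono => //; first exact: H_cst.
by move=> w; apply: le_trans (AX w); rewrite indicE.
Qed.

Lemma capV_setT : V setT = 1%E.
Proof.
apply/eqP; rewrite eq_le; apply/andP; split.
  rewrite -(E_cst 1); apply: capV_le_E; first exact: H_cst.
  by move=> w; rewrite indicE in_setT.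
apply: le_ereal_inf_tmp => _ [X [HX AX] <-].
rewrite -(E_cst 1); apply: E_mono => //; first exact: H_cst.
by move=> w; apply: le_trans (AX w); rewrite indicE in_setT.
Qed.

Lemma capV_le1 A : (V A <= 1)%E.
Proof. by rewrite -capV_setT; exact: capV_mono. Qed.

Definition Vr A : R := fine (V A).

Lemma capVE A : V A = (Vr A)%:E.
Proof.
rewrite /Vr fineK// ge0_fin_numE ?capV_ge0//.
exact: le_lt_trans (capV_le1 A) (ltry 1).
Qed.
Lemma Vr_ge0 A : 0 <= Vr A. Proof. by rewrite -lee_fin -capVE capV_ge0. Qed.
Lemma Vr_le1 A : Vr A <= 1. Proof. by rewrite -lee_fin -capVE capV_le1. Qed.
Lemma Vr_mono A B : A `<=` B -> Vr A <= Vr B.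
Proof. by move=> AB; rewrite -lee_fin -!capVE capV_mono. Qed.
Lemma Vr_le_Er A X : bdH X -> (forall w, \1_A w <= X w) -> Vr A <= Er X.
Proof.
by move=> bX AX; rewrite -lee_fin -capVE -E_bdH//; apply: capV_le_E => //; case: bX.
Qed.
Lemma Vr_indic A : measurable A -> Vr A = Er (\1_A).
Proof.
move=> mA; apply/eqP; rewrite eq_le Vr_le_Er//=; last exact: bdH_indic.
rewrite -lee_fin -capVE -E_bdH; last exact: bdH_indic.
apply: le_ereal_inf_tmp => _ [X [HX AX] <-]; apply: E_mono => //; exact: H_indic.
Qed.
Lemma Vr_set0 : Vr set0 = 0.
Proof.
rewrite Vr_indic// -[RHS](Er_cst 0); congr Er.
by apply/funext => w; rewrite indicE in_set0.
Qed.
Lemma Vr_subadd A B : measurable A -> measurable B -> Vr (A `|` B) <= Vr A + Vr B.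
Proof.
move=> mA mB; have bA := bdH_indic mA; have bB := bdH_indic mB.
rewrite (Vr_indic mA) (Vr_indic mB); apply: le_trans (Er_add bA bB).
apply: Vr_le_Er; first exact: bdH_add.
by move=> w; rewrite !indicE in_setU; case: (_ \in A); case: (_ \in B) => //=; lra.
Qed.
Lemma Vr_bigU (B : nat -> set Omega) n : (forall i, measurable (B i)) ->
  Vr [set w | exists i, (i < n)%N /\ B i w] <= \sum_(0 <= i < n) Vr (B i).
Proof.
move=> mB; have UE m : [set w | exists i, (i < m)%N /\ B i w] = \bigcup_(i in `I_m) B i.
  by apply/seteqP; split => w [i]; [case=> a b; exists i|move=> a b; exists i].
elim: n => [|n IH]; first by rewrite UE II0 bigcup_set0 Vr_set0 big_geq.
rewrite big_nat_recr//=; apply: le_trans (lerD IH (lexx _)).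
apply: le_trans (Vr_subadd _ _) => //; last first.
  by rewrite UE; apply: bigcup_measurable => i _.
apply: Vr_mono => w [i []]; rewrite ltnS leq_eqVlt => /orP[/eqP ->|]; first by right.
by left; exists i.
Qed.

End SublinearSpace.

(** * Independence *)

Section Independence.
Set Implicit Arguments. Unset Strict Implicit. Unset Printing Implicit Defensive.
Context {d : measure_display} {Omega : measurableType d} {R : realType}.
Context (H : set (Omega -> R)) (E : (Omega -> R) -> \bar R).
Context (hS : sublinear_space H E).
Context {Xs : nat -> Omega -> R} {X : Omega -> R}.
Context (HX : H X) (HXs : forall k, H (Xs k)).
Context (hind : forall n : nat, (0 < n)%N -> indep H E (fun i : 'I_n => Xs i) (Xs n)).
Context (hid : forall k, ident_distr H E (Xs k) X).

Local Notation V := (Vr H E).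
Local Notation bdH := (bdH H).
Local Notation Er := (Er E).

(** Translates the level-set conditions of [borel1] and [borel2] into measurability for the
    generated sigma-algebra, which is stable under the usual operations. *)
Lemma measurable_generated (T : pointedType) (G : set (set T)) (f : T -> R) :
  (forall c : R, <<s G >> [set t | f t < c]) ->
  measurable_fun [set: g_sigma_algebraType G] (f : g_sigma_algebraType G -> R).
Proof.
move=> h; apply: (measurability _ (RGenInftyO.measurableE R)).
move=> _ [_ [c ->] <-]; rewrite setTI.
suff -> : f @^-1` `]-oo, c[ = [set t | f t < c] by exact: h.
by apply/seteqP; split => t /=; rewrite in_itv.
Qed.

Lemma generated_measurable (T : pointedType) (G : set (set T)) (f : T -> R) :
  measurable_fun [set: g_sigma_algebraType G] (f : g_sigma_algebraType G -> R) ->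
  forall c : R, <<s G >> [set t | f t < c].
Proof.
move=> mf c.
have := mf measurableT `]-oo, c[%classic (measurable_itv _).
rewrite setTI; suff -> : f @^-1` `]-oo, c[ = [set t | f t < c] by [].
by apply/seteqP; split => t /=; rewrite in_itv.
Qed.

Lemma borel1_measurable (f : R -> R) : measurable_fun setT f -> borel1 f.
Proof.
move=> mf; apply: generated_measurable.
apply: (measurableT_comp mf).
by apply: (@measurable_generated R _ idfun) => c; apply: sub_sigma_algebra; exists c.
Qed.

Lemma Er_ident k (f : R -> R) : measurable_fun setT f -> bdH (f \o Xs k) ->
  bdH (f \o X) -> Er (f \o Xs k) = Er (f \o X).
Proof.
move=> mf b1 b2; rewrite /Er (hid (borel1_measurable mf))//.
- by case: b1.
- by case: b2.
- by rewrite (E_bdH hS b1).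
- by rewrite (E_bdH hS b2).
Qed.

Definition ext n (x : 'I_n -> R) (k : nat) : R :=
  if insub k is Some i then x i else 0.

Lemma ext_lt n (x : nat -> R) k : (k < n)%N -> ext (fun i : 'I_n => x i) k = x k.
Proof. by move=> kn; rewrite /ext insubT. Qed.

Definition gen2 n : set (set (('I_n -> R) * R)) :=
  [set A : set (('I_n -> R) * R) |
          (exists (i : 'I_n) (c' : R), A = [set z | z.1 i < c']) \/
          (exists c' : R, A = [set z | z.2 < c'])].

(* Functionals of the whole sequence that depend on finitely many coordinates;
   the vectors [x : 'I_n -> R] of [indep] are extended by 0. *)
Definition cylinder n (A : (nat -> R) -> R) :=
  (forall x y, (forall k, (k < n)%N -> x k = y k) -> A x = A y) /\
  (forall N, measurable_fun [set: g_sigma_algebraType (@gen2 N)]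
     (fun z : g_sigma_algebraType (@gen2 N) => A (ext z.1))).

Lemma cylinder_coord n (f : R -> R) k : (k < n)%N -> measurable_fun setT f ->
  cylinder n (fun x => f (x k)).
Proof.
move=> kn mf; split; first by move=> x y xy; rewrite xy.
move=> N; apply: (measurableT_comp mf); rewrite /ext.
case: insubP => [i _ _|_]; last exact: measurable_cst.
apply: (@measurable_generated _ (@gen2 N) (fun z => z.1 i)) => c.
by apply: sub_sigma_algebra; left; exists i, c.
Qed.

Lemma cylinder_comp n (f : R -> R) A : measurable_fun setT f -> cylinder n A ->
  cylinder n (fun x => f (A x)).
Proof.
move=> mf [h1 h2]; split; first by move=> x y xy; rewrite (h1 x y xy).
by move=> N; apply: (measurableT_comp mf).
Qed.

Lemma cylinder_mul n A B : cylinder n A -> cylinder n B -> cylinder n (fun x => A x * B x).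
Proof.
move=> [A1 A2] [B1 B2]; split; first by move=> x y xy; rewrite (A1 x y xy) (B1 x y xy).
by move=> N; exact: measurable_funM.
Qed.

Lemma cylinder_add n A B : cylinder n A -> cylinder n B -> cylinder n (fun x => A x + B x).
Proof.
move=> [A1 A2] [B1 B2]; split; first by move=> x y xy; rewrite (A1 x y xy) (B1 x y xy).
by move=> N; exact: measurable_funD.
Qed.

Lemma cylinder_cst n c : cylinder n (fun=> c).
Proof. by split=> // N; exact: measurable_cst. Qed.

Lemma cylinderS n A : cylinder n A -> cylinder n.+1 A.
Proof. by move=> [A1 A2]; split=> // x y xy; apply: A1 => k kn; apply: xy; rewrite ltnW. Qed.

(** For a fixed past [x] the map [y |-> A x + B x * g y] has expectation [A x + B x * Er g] exactly,
    by translation and homogeneity with [B x >= 0]; independence then replaces [g (Xs n)] by its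
    expectation. *)
Lemma indep_step n A B (g : R -> R) : cylinder n A -> cylinder n B ->
  measurable_fun setT g ->
  (forall x, 0 <= A x) -> (forall x, 0 <= B x) -> (forall y, 0 <= g y) ->
  bdH (fun w => A (fun k => Xs k w)) -> bdH (fun w => B (fun k => Xs k w)) ->
  bdH (g \o Xs n) ->
  Er (fun w => A (fun k => Xs k w) + B (fun k => Xs k w) * g (Xs n w)) =
  Er (fun w => A (fun k => Xs k w) + B (fun k => Xs k w) * Er (g \o Xs n)).
Proof.
move=> [A1 A2] [B1 B2] mg A0 B0 g0 bA bB bg.
have aff a b : 0 <= b -> Er (fun w => a + b * g (Xs n w)) = a + b * Er (g \o Xs n).
  by move=> b0; rewrite (Er_translate hS)//; [rewrite (Er_scale hS)|exact: (bdH_scale hS)].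
(* [hind] speaks of [n > 0]; for [n = 0] there is no past, and [A], [B] are constants. *)
case: (posnP n) => [n0|n0].
  have cA w : A (fun k => Xs k w) = A (fun=> 0) by apply: A1 => k; rewrite n0.
  have cB w : B (fun k => Xs k w) = B (fun=> 0) by apply: B1 => k; rewrite n0.
  under eq_fun do rewrite cA cB.
  under [in RHS]eq_fun do rewrite cA cB.
  by rewrite aff// (Er_cst hS).
have eA w : A (ext (fun i : 'I_n => Xs i w)) = A (fun k => Xs k w).
  by apply: A1 => k kn; rewrite (ext_lt (fun j => Xs j w)).
have eB w : B (ext (fun i : 'I_n => Xs i w)) = B (fun k => Xs k w).
  by apply: B1 => k kn; rewrite (ext_lt (fun j => Xs j w)).
pose psi (x : 'I_n -> R) (y : R) := A (ext x) + B (ext x) * g y.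
have psi0 x y : 0 <= psi x y by rewrite addr_ge0// mulr_ge0.
have e0 : 0 <= Er (g \o Xs n) by apply: (Er_ge0 hS) => // w; exact: g0.
have bpsi x : bdH (fun w => psi x (Xs n w)).
  by apply: (bdH_add hS); [exact: (bdH_cst hS)|exact: (bdH_scale hS)].
have bh : bdH (fun w => A (fun k => Xs k w) + B (fun k => Xs k w) * Er (g \o Xs n)).
  by apply: (bdH_add hS) => //; apply: (bdH_mul hS) => //; exact: (bdH_cst hS).
have hE : (fun x => fine (E (fun w => psi x (Xs n w)))) =
   (fun x => A (ext x) + B (ext x) * Er (g \o Xs n)).
  by apply/funext => x; exact: aff.
(* As [psi >= 0], the functions [psibar] and [h] of [indep] coincide, and one boundedness argument
   covers both. *)
have hbarE : (fun x => fine (E (fun w => `|psi x (Xs n w)|))) =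
   (fun x => A (ext x) + B (ext x) * Er (g \o Xs n)).
  rewrite -hE; apply/funext => x; congr (fine (E _)); apply/funext => w.
  by rewrite ger0_norm.
have hcomp : (fun w => A (ext (fun i : 'I_n => Xs i w)) + B (ext (fun i : 'I_n => Xs i w)) * Er (g \o Xs n)) =
   (fun w => A (fun k => Xs k w) + B (fun k => Xs k w) * Er (g \o Xs n)).
  by apply/funext => w; rewrite eA eB.
have pcomp : (fun w => psi (fun i : 'I_n => Xs i w) (Xs n w)) =
   (fun w => A (fun k => Xs k w) + B (fun k => Xs k w) * g (Xs n w)).
  by apply/funext => w; rewrite /psi eA eB.
have hi (pb h : ('I_n -> R) -> R) :
  pb = (fun x => fine (E (fun w => `|psi x (Xs n w)|))) ->
  h = (fun x => fine (E (fun w => psi x (Xs n w)))) ->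
  borel2 psi -> H (fun w => psi (fun i : 'I_n => Xs i w) (Xs n w)) ->
  (forall x, H (fun w => psi x (Xs n w))) ->
  (forall x, (E (fun w => `|psi x (Xs n w)|%R) < +oo)%E) ->
  H (fun w => pb (fun i : 'I_n => Xs i w)) ->
  (E (fun w => `|pb (fun i : 'I_n => Xs i w)|%R) < +oo)%E ->
  H (fun w => h (fun i : 'I_n => Xs i w)) ->
  E (fun w => psi (fun i : 'I_n => Xs i w) (Xs n w)) = E (fun w => h (fun i : 'I_n => Xs i w)).
  by move=> -> -> k1 k2 k3 k4 k5 k6 k7; exact: (hind n0 k1 k2 k3 k4 k5 k6 k7).
have := hi _ _ (esym hbarE) (esym hE); rewrite hcomp pcomp => {}hi.
rewrite /Er hi//.
- apply: (@generated_measurable _ (@gen2 n) (fun z => psi z.1 z.2)).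
  apply: measurable_funD; first exact: A2.
  apply: measurable_funM; first exact: B2.
  apply: (measurableT_comp mg).
  apply: (@measurable_generated _ (@gen2 n) (fun z => z.2)) => c.
  by apply: sub_sigma_algebra; right; exists c.
- apply: (H_add hS); first by case: bA.
  by apply: (H_mul hS); [case: bB|case: bg].
- by move=> x; case: (bpsi x).
- move=> x; under eq_fun do rewrite (ger0_norm (psi0 _ _)).
  by rewrite (E_bdH hS (bpsi x)) ltry.
- by case: bh.
- have -> : (fun w => `|A (ext (fun i : 'I_n => Xs i w)) + B (ext (fun i : 'I_n => Xs i w)) * Er (g \o Xs n)|) =
     (fun w => A (fun k => Xs k w) + B (fun k => Xs k w) * Er (g \o Xs n)).
    by apply/funext => w; rewrite eA eB ger0_norm// addr_ge0// mulr_ge0.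
  by rewrite (E_bdH hS bh) ltry.
- by case: bh.
Qed.


Let Xw (w : Omega) : nat -> R := fun k => Xs k w.

Lemma measurable_gtb (c : R) : measurable_fun setT (fun t : R => (c < t)%R%:R : R).
Proof.
rewrite (_ : (fun t : R => _) = (fun t : R => if (c < t)%R then 1 else 0)); last first.
  by apply/funext => t; case: ifP.
apply: measurable_fun_ifT => //.
by apply: measurable_fun_ltr.
Qed.

Lemma measurable_set_gt (Y : Omega -> R) (c : R) : H Y -> measurable [set w | c < Y w].
Proof.
move=> HY; have := H_measurable hS HY measurableT (measurable_itv `]c, +oo[).
rewrite setTI; suff -> : Y @^-1` `]c, +oo[ = [set w | c < Y w] by [].
by apply/seteqP; split => w /=; rewrite in_itv/= andbT.
Qed.

Let indic_gt (Y : Omega -> R) (c : R) :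
  \1_[set w | c < Y w] = (fun w => (c < Y w)%R%:R) :> (Omega -> R).
Proof.
by apply/funext => w; rewrite indicE; congr (_%:R); congr nat_of_bool; apply/idP/idP; rewrite inE.
Qed.

Lemma bdH_gtb (Y : Omega -> R) (c : R) : H Y -> bdH (fun w => (c < Y w)%R%:R).
Proof. by move=> HY; rewrite -indic_gt; exact: (bdH_indic hS (measurable_set_gt c HY)). Qed.

Lemma V_gtE (Y : Omega -> R) (c : R) : H Y ->
  V [set w | c < Y w] = Er (fun w => (c < Y w)%R%:R).
Proof. by move=> HY; rewrite (Vr_indic hS (measurable_set_gt c HY)) indic_gt. Qed.

(** * A maximal inequality for products of nonnegative functions *)

Section Ville.
Context (g : nat -> R -> R) (mg : forall k, measurable_fun setT (g k)).
Context (g0 : forall k y, 0 <= g k y) (bg : forall k, bdH (g k \o Xs k)).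
Context (lam : R) (lam1 : 1 <= lam).

(* The product of the [g k (x k)], stopped when it first exceeds [lam]. *)
Fixpoint stopped n (x : nat -> R) : R :=
  if n is m.+1 then
    stopped m x * (lam < stopped m x)%R%:R +
    stopped m x * (1 - (lam < stopped m x)%R%:R) * g m (x m)
  else 1.

Let st_ge0 n x : 0 <= stopped n x.
Proof.
elim: n => [|n IH]//=; rewrite addr_ge0// !mulr_ge0//.
by case: (_ < _); rewrite ?subrr ?subr0.
Qed.

Let st_cyl n : cylinder n (stopped n) /\ cylinder n (fun x => stopped n x * (lam < stopped n x)%R%:R)
  /\ cylinder n (fun x => stopped n x * (1 - (lam < stopped n x)%R%:R)).
Proof.
have K m : cylinder m (stopped m) -> [/\ cylinder m (stopped m),
  cylinder m (fun x => stopped m x * (lam < stopped m x)%R%:R) &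
  cylinder m (fun x => stopped m x * (1 - (lam < stopped m x)%R%:R))].
  move=> h; split => //; apply: cylinder_mul => //.
    exact: (cylinder_comp (measurable_gtb lam)).
  apply: (cylinder_comp (f := fun t => 1 - (lam < t)%R%:R)) => //.
  by apply: measurable_funB => //; exact: measurable_gtb.
suff h : cylinder n (stopped n) by have [] := K _ h.
elim: n => [|n IH]; first exact: cylinder_cst.
have [_ h2 h3] := K _ IH.
rewrite /=; apply: cylinder_add; first exact: cylinderS.
apply: cylinder_mul; first exact: cylinderS.
exact: cylinder_coord.
Qed.

Let st_bd n : [/\ bdH (fun w => stopped n (Xw w)),
  bdH (fun w => stopped n (Xw w) * (lam < stopped n (Xw w))%R%:R) &
  bdH (fun w => stopped n (Xw w) * (1 - (lam < stopped n (Xw w))%R%:R))].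
Proof.
have K m : bdH (fun w => stopped m (Xw w)) -> [/\ bdH (fun w => stopped m (Xw w)),
  bdH (fun w => stopped m (Xw w) * (lam < stopped m (Xw w))%R%:R) &
  bdH (fun w => stopped m (Xw w) * (1 - (lam < stopped m (Xw w))%R%:R))].
  move=> h; have h1 : bdH (fun w => (lam < stopped m (Xw w))%R%:R).
    by apply: bdH_gtb; case: h.
  split => //; apply: (bdH_mul hS) => //.
  by apply: (bdH_add hS); [exact: (bdH_cst hS)|exact: (bdH_opp hS)].
elim: n => [|n [_ h2 h3]]; first by apply: K; exact: (bdH_cst hS).
apply: K => /=; apply: (bdH_add hS) => //; apply: (bdH_mul hS) => //.
exact: bg.
Qed.

(** One step multiplies by 1 after the stopping and by [Er (g n)] in mean before it, hence by at
    most the maximum of the two. *)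
Let st_Er n : Er (fun w => stopped n (Xw w)) <= \prod_(0 <= k < n) Num.max 1 (Er (g k \o Xs k)).
Proof.
elim: n => [|n IH]; first by rewrite big_geq// (Er_cst hS).
have [_ [c2 c3]] := st_cyl n; have [b1 b2 b3] := st_bd n.
rewrite big_nat_recr//= (indep_step c2 c3)//; last 2 first.
- by move=> x; rewrite mulr_ge0//.
- by move=> x; rewrite mulr_ge0//; case: (_ < _); rewrite ?subrr ?subr0.
set e := Er _; set M := Num.max _ _.
have M0 : 0 <= M by rewrite le_max ler01.
apply: (@le_trans _ _ (Er (fun w => M * stopped n (Xw w)))).
  apply: (Er_le hS).
  - apply: (bdH_add hS) => //; apply: (bdH_mul hS) => //; exact: (bdH_cst hS).
  - exact: (bdH_scale hS).
  move=> w; rewrite -mulrA -mulrDr mulrC ler_wpM2r//.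
  case: (_ < _); first by rewrite subrr mul0r addr0 le_max lexx.
  by rewrite subr0 mul1r add0r le_max lexx orbT.
by rewrite (Er_scale hS)// mulrC ler_wpM2r.
Qed.

Let st_prod n x : (lam < stopped n x) \/
  (stopped n x = \prod_(0 <= k < n) g k (x k) /\
   forall j, (j <= n)%N -> \prod_(0 <= k < j) g k (x k) <= lam).
Proof.
elim: n => [|n [h|[h1 h2]]].
- by right; rewrite big_geq//; split=> // j; rewrite leqn0 => /eqP ->; rewrite big_geq.
- by left; rewrite /= h/= subrr mulr1 mulr0 mul0r addr0.
have hn : (lam < stopped n x) = false.
  by apply/negbTE; rewrite -leNgt h1 h2.
have e : stopped n.+1 x = \prod_(0 <= k < n.+1) g k (x k).
  by rewrite /= hn mulr0 add0r subr0 mulr1 h1 big_nat_recr.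
case: (ltP lam (stopped n.+1 x)) => h; [by left|right; split=> // j].
by rewrite leq_eqVlt => /orP[/eqP ->|/h2//]; rewrite -e.
Qed.

(** A stopped product that has passed [lam] stays there, so every crossing up to time [n] is visible
    at time [n], where Markov's inequality applies. *)
Lemma ville n : V [set w | exists j, (j <= n)%N /\ lam < \prod_(0 <= k < j) g k (Xs k w)] <=
  lam^-1 * \prod_(0 <= k < n) Num.max 1 (Er (g k \o Xs k)).
Proof.
have lam0 : 0 < lam := lt_le_trans ltr01 lam1.
have [b1 _ _] := st_bd n.
apply: le_trans (ler_wpM2l _ (st_Er n)); last by rewrite invr_ge0 ltW.
rewrite -(Er_scale hS)//; last by rewrite invr_ge0 ltW.
apply: (Vr_le_Er hS); first exact: (bdH_scale hS).
move=> w; rewrite indicE; case: (boolP (w \in _)) => [|_]; last first.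
  by rewrite mulr_ge0// invr_ge0 ltW.
rewrite inE => -[j [jn hj]]; rewrite ler_pdivlMl// mulr1.
have [/ltW//|[_ h]] := st_prod n (Xw w).
by have := h j jn; rewrite leNgt hj.
Qed.

End Ville.

Lemma measurable_abs_gtb (t : R) : measurable_fun setT (fun y : R => (t < `|y|)%R%:R : R).
Proof. by apply: (measurableT_comp (measurable_gtb t)). Qed.

Lemma abs_gtb_bdH (Y : Omega -> R) (t : R) : H Y -> bdH ((fun y : R => (t < `|y|)%R%:R) \o Y).
Proof. by move=> HY; exact: (bdH_gtb _ (H_norm hS HY)). Qed.

Lemma V_abs_gt k t : V [set w | t < `|Xs k w|] = V [set w | t < `|X w|].
Proof.
rewrite !V_gtE; [|exact: (H_norm hS)..].
exact: (Er_ident (measurable_abs_gtb t) (abs_gtb_bdH t (HXs k)) (abs_gtb_bdH t HX)).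
Qed.

(** * Capacity of a union of independent events *)

Section Union.
Context (c : nat -> R).

(* Indicator of the union of the events [c k < `|x k|], [k < n]. *)
Fixpoint hit n (x : nat -> R) : R :=
  if n is m.+1 then hit m x + (1 - hit m x) * (c m < `|x m|)%R%:R else 0.

Let hit01 n x : hit n x = (has (fun k => c k < `|x k|)%R (iota 0 n))%:R.
Proof.
elim: n => [//|n IH]; rewrite -[in iota _ n.+1](addn1 n) iotaD has_cat [hit _ _]/= IH /= orbF.
by case: has; case: (_ < _); rewrite /= ?subrr ?mul0r ?mulr0 ?addr0 ?subr0 ?mulr1 ?add0r.
Qed.

Let hit_cyl n : cylinder n (hit n) /\ cylinder n (fun x => 1 - hit n x).
Proof.
have K m : cylinder m (hit m) -> cylinder m (hit m) /\ cylinder m (fun x => 1 - hit m x).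
  move=> h; split=> //; apply: (cylinder_comp (f := fun t => 1 - t)) => //.
  exact: measurable_funB.
elim: n => [|n [h1 h2]]; apply: K; first exact: cylinder_cst.
rewrite /=; apply: cylinder_add; first exact: cylinderS.
apply: cylinder_mul; first exact: cylinderS.
by apply: (cylinder_coord (f := fun y => (c n < `|y|)%R%:R)) => //; exact: measurable_abs_gtb.
Qed.

Let hit_bd n : bdH (fun w => hit n (Xw w)) /\ bdH (fun w => 1 - hit n (Xw w)).
Proof.
have K m : bdH (fun w => hit m (Xw w)) -> bdH (fun w => hit m (Xw w)) /\ bdH (fun w => 1 - hit m (Xw w)).
  move=> h; split=> //.
  by apply: (bdH_add hS); [exact: (bdH_cst hS)|exact: (bdH_opp hS)].
elim: n => [|n [h1 h2]]; apply: K; first exact: (bdH_cst hS).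
rewrite /=; apply: (bdH_add hS) => //; apply: (bdH_mul hS) => //.
exact: (abs_gtb_bdH (c n) (HXs n)).
Qed.

(** Both [hit n] and [1 - hit n] are nonnegative, so [indep_step] applies; the result
    [v + (1 - v) * hit n] is affine in [hit n] with slope [1 - v >= 0], and equality is
    preserved. *)
Let hit_Er n : 1 - Er (fun w => hit n (Xw w)) =
  \prod_(0 <= k < n) (1 - V [set w | c k < `|X w|]).
Proof.
elim: n => [|n IH]; first by rewrite big_geq// (Er_cst hS) subr0.
have [c1 c2] := hit_cyl n; have [b1 b2] := hit_bd n.
have h0 x : 0 <= hit n x by rewrite hit01.
have h1 x : 0 <= 1 - hit n x by rewrite hit01; case: has; rewrite ?subrr ?subr0.
rewrite big_nat_recr//= -IH (indep_step c1 c2 (measurable_abs_gtb (c n)) h0 h1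
  (fun y => ler0n _ _) b1 b2 (abs_gtb_bdH (c n) (HXs n))).
have -> : Er ((fun y : R => (c n < `|y|)%R%:R) \o Xs n) = V [set w | c n < `|X w|].
  by rewrite -(V_abs_gt n) V_gtE//; exact: (H_norm hS).
set v := V _.
have -> : (fun w => hit n (fun k => Xs k w) + (1 - hit n (fun k => Xs k w)) * v) =
  (fun w => v + (1 - v) * hit n (Xw w)) by apply/funext => w; rewrite /Xw; ring.
rewrite (Er_translate hS); last exact: (bdH_scale hS).
by rewrite (Er_scale hS)// ?subr_ge0 ?Vr_le1//; ring.
Qed.

Lemma V_union_ge n : 1 - expR (- \sum_(0 <= k < n) V [set w | c k < `|X w|]) <=
  V [set w | exists k, (k < n)%N /\ c k < `|Xs k w|].
Proof.
have [b1 _] := hit_bd n.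
apply: (@le_trans _ _ (Er (fun w => hit n (Xw w)))).
  rewrite lerBlDr addrC -lerBlDr hit_Er -sumrN expR_sum.
  apply: ler_prod => k _; rewrite subr_ge0 (Vr_le1 hS)/=.
  exact: expR_ge1Dx.
suff -> : [set w | exists k, (k < n)%N /\ c k < `|Xs k w|] = [set w | 0 < hit n (Xw w)].
  rewrite V_gtE; last by case: b1.
  suff -> : (fun w => (0 < hit n (Xw w))%R%:R) = (fun w => hit n (Xw w)) by [].
  by apply/funext => w; rewrite hit01; case: has; rewrite ?ltr01 ?ltxx.
apply/seteqP; split => w /=; rewrite hit01.
  move=> [k [kn hk]]; suff -> : has (fun k => c k < `|Xw w k|) (iota 0 n) by [].
  by apply/hasP; exists k => //; rewrite mem_iota.
case: (boolP (has _ _)) => [/hasP[k]|]; last by rewrite ltxx.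
by rewrite mem_iota add0n => kn hk _; exists k.
Qed.

End Union.

End Independence.

(** * Choquet integrals *)

Section SeriesAndIntegrals.
Set Implicit Arguments. Unset Strict Implicit. Unset Printing Implicit Defensive.
Context {R : realType}.
Implicit Types (u : nat -> R).

Lemma bsum_shift u : (forall n, 0 <= u n) -> bsum (fun n => u n.+1) <-> bsum u.
Proof.
move=> u0; split=> [[B hB]|[B hB]].
  exists (u 0%N + B) => -[|N].
    by rewrite big_geq// addr_ge0//; have := hB 0%N; rewrite big_geq.
  by rewrite big_nat_recl// lerD2l.
by exists B => N; apply: le_trans (hB N.+1); rewrite big_nat_recl// lerDr.
Qed.

Lemma nneseries_ltyP (m : nat) u : (forall k, 0 <= u k) ->
  (\sum_(m <= k <oo) (u k)%:E < +oo)%E <->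
  exists B : R, forall N, \sum_(m <= i < N) u i <= B.
Proof.
move=> u0; have e0 n : (m <= n)%N -> true -> (0 <= (u n)%:E)%E by rewrite lee_fin.
split=> [h|[B hB]].
  have S0 : (0 <= \sum_(m <= k <oo) (u k)%:E)%E by apply: nneseries_ge0 => n _ _; rewrite lee_fin.
  exists (fine (\sum_(m <= k <oo) (u k)%:E)) => N.
  rewrite -lee_fin fineK; last by rewrite ge0_fin_numE.
  by rewrite -sumEFin; exact: nneseries_lim_ge.
apply: (@le_lt_trans _ _ B%:E); last exact: ltry.
apply: lime_le; first exact: is_cvg_nneseries.
by apply: nearW => N; rewrite sumEFin lee_fin.
Qed.

Lemma nneseries1_bsum u : (forall k, 0 <= u k) ->
  (\sum_(1 <= k <oo) (u k)%:E < +oo)%E <-> bsum u.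
Proof.
move=> u0; rewrite nneseries_ltyP//; split=> -[B hB].
  exists (u 0%N + B) => -[|N].
    by rewrite big_geq// addr_ge0//; have := hB 0%N; rewrite big_geq.
  by rewrite big_ltn// lerD2l.
exists B => -[|N]; first by rewrite big_geq//; have := hB 0%N; rewrite big_geq.
by apply: le_trans (hB N.+1); rewrite [X in _ <= X]big_ltn// lerDr.
Qed.

Lemma nneseries0_bsum u : (forall k, 0 <= u k) ->
  (\sum_(0 <= k <oo) (u k)%:E < +oo)%E <-> bsum u.
Proof. by move=> u0; rewrite nneseries_ltyP. Qed.

Notation mu := (@lebesgue_measure R).

Context (G : R -> R) (G0 : forall x, 0 <= G x).
Context (Ganti : forall x y, x <= y -> G y <= G x).

Lemma measurable_antitone (D : set R) : measurable D -> measurable_fun D (EFin \o G).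
Proof.
move=> mD; apply/measurable_EFinP; by apply: nonincreasing_measurable.
Qed.

Lemma integral_antitone_itv (a b : R) : a <= b ->
  exists P : R, (\int[mu]_(x in `[a, b[) (G x)%:E)%E = P%:E /\
    (b - a) * G b <= P /\ P <= (b - a) * G a.
Proof.
move=> ab; have mI : measurable (`[a, b[%classic : set R) by exact: measurable_itv.
have cstE c : (\int[mu]_(x in `[a, b[) c%:E)%E = ((b - a) * c)%:E.
  transitivity (c%:E * mu `[a, b[%classic)%E; first exact: (integral_cst mu mI c%:E).
  rewrite lebesgue_measure_itv/= lte_fin.
  case: ltP => ba; first by rewrite -EFinB -EFinM mulrC.
  have -> : b = a by apply/eqP; rewrite eq_le ab ba.
  by rewrite mule0 subrr mul0r.
have mc c : measurable_fun (`[a, b[%classic : set R) (cst c%:E : R -> \bar R) by exact: measurable_cst.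
have up : (\int[mu]_(x in `[a, b[) (G x)%:E <= ((b - a) * G a)%:E)%E.
  rewrite -cstE; apply: ge0_le_integral => //.
  - by move=> x _; rewrite lee_fin.
  - exact: measurable_antitone.
  - by move=> x /=; rewrite in_itv/= lee_fin => /andP[ax _]; exact: Ganti.
have dn : (((b - a) * G b)%:E <= \int[mu]_(x in `[a, b[) (G x)%:E)%E.
  rewrite -cstE; apply: ge0_le_integral => //.
  - by move=> x _; rewrite lee_fin.
  - exact: measurable_antitone.
  - by move=> x /=; rewrite in_itv/= lee_fin => /andP[_ xb]; apply: Ganti; exact: ltW.
exists (fine (\int[mu]_(x in `[a, b[) (G x)%:E)%E).
have fn : (\int[mu]_(x in `[a, b[) (G x)%:E)%E \is a fin_num.
  rewrite ge0_fin_numE; first exact: le_lt_trans up (ltry _).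
  by apply: integral_ge0 => x _; rewrite lee_fin.
by split; [rewrite fineK|split; rewrite -lee_fin fineK].
Qed.

Lemma integral_antitone_series (a : nat -> R) : a 0%N = 0 ->
  (forall k, a k <= a k.+1) -> (forall x, exists k, x < a k) ->
  (\int[mu]_(x in [set x : R | (0 <= x)%R]) (G x)%:E =
   \sum_(0 <= k <oo) \int[mu]_(x in `[a k, a k.+1[) (G x)%:E)%E.
Proof.
move=> a0 ai ainf.
have amono : {homo a : m n / (m <= n)%N >-> m <= n}.
  by apply: homo_leq => //; exact: le_trans.
have -> : [set x : R | 0 <= x] = \bigcup_k `[a k, a k.+1[%classic.
  apply/seteqP; split => [x /= x0|x [k _] /=]; last first.
    by rewrite in_itv/= => /andP[+ _]; apply: le_trans; rewrite -a0 amono.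
  have [k hk kmin] := ex_minnP (ainf x).
  case: k hk kmin => [|k] hk kmin; first by move: hk; rewrite a0 ltNge x0.
  exists k => //=; rewrite in_itv/= hk andbT leNgt; apply/negP => /kmin.
  by rewrite ltnn.
apply: ge0_integral_bigcup.
- by move=> k; exact: measurable_itv.
- by apply: measurable_antitone; apply: bigcupT_measurable => k; exact: measurable_itv.
- by move=> x _; rewrite lee_fin.
apply/trivIsetP => i j _ _ ij; apply/seteqP; split => // x [] /=.
rewrite !in_itv/= => /andP[h1 h2] /andP[h3 h4].
move: ij; rewrite neq_lt => /orP[] /amono h.
  by move: (lt_le_trans h2 (le_trans h h3)); rewrite ltxx.
by move: (lt_le_trans h4 (le_trans h h1)); rewrite ltxx.
Qed.

End SeriesAndIntegrals.

Section Choquet.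
Set Implicit Arguments. Unset Strict Implicit. Unset Printing Implicit Defensive.
Context {d : measure_display} {Omega : measurableType d} {R : realType}.
Context (H : set (Omega -> R)) (E : (Omega -> R) -> \bar R).
Context (hS : sublinear_space H E) (X : Omega -> R).

Definition tailF (x : R) : R := Vr H E [set w | x < `|X w|].

Lemma tailF_ge0 x : 0 <= tailF x. Proof. exact: (Vr_ge0 hS). Qed.
Lemma tailF_anti x y : x <= y -> tailF y <= tailF x.
Proof. by move=> xy; apply: (Vr_mono hS) => w /=; exact: le_lt_trans. Qed.

Lemma choquet_ge0 (Y : Omega -> R) : (forall w, 0 <= Y w) ->
  choquetE (capV H E) Y =
  (\int[@lebesgue_measure R]_(x in [set x : R | (0 <= x)%R]) (Vr H E [set w | (x < Y w)%R])%:E)%E.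
Proof.
move=> Y0; rewrite /choquetE [X in (_ + X)%E](@integral0_eq _ _ _ _ _ _) ?adde0.
  by apply: eq_integral => x _; exact: (capVE hS).
move=> x /= x0; suff -> : [set w | x < Y w] = setT by rewrite (capV_setT hS) subee.
by apply/seteqP; split => // w _ /=; exact: lt_le_trans (Y0 w).
Qed.

(* The Choquet integral is compared with its Riemann sums over the geometric
   mesh [phi (D * 2 ^ (s p))]. *)
Lemma choquet_bsum (phi : R -> R) (p D l L : R) :
  (forall a b, 0 <= a -> 0 <= b -> (phi a < phi b) = (a < b)) ->
  (forall a, 0 <= a -> 0 <= phi a) -> 0 < D -> 0 <= l -> l < 1 -> 0 <= L ->
  (forall s, phi (D * tw (s%:R * p)) <= l * phi (D * tw (s.+1%:R * p))) ->
  (forall s, phi (D * tw (s.+1%:R * p)) <= L * phi (D * tw (s%:R * p))) ->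
  (choquetE (capV H E) (fun w => phi `|X w|)%R < +oo)%E <->
  bsum (weighted tailF p D (fun s => phi (D * tw (s%:R * p)))).
Proof.
move=> phi_lt phi0 D0 l0 l1 L0 hl hL.
pose t s : R := D * tw (s%:R * p); pose A s := phi (t s).
have t0 s : 0 < t s by rewrite mulr_gt0 ?tw_gt0.
have A0 s : 0 < A s.
  by apply: le_lt_trans (phi0 0 (lexx _)) _; rewrite phi_lt ?(ltW (t0 s)).
pose a k := if k is k'.+1 then A k' else 0.
have AS s : A s <= A s.+1.
  by apply: le_trans (hl s) _; rewrite ler_piMl ?ltW// -/(A _) A0.
pose G x := Vr H E [set w | x < phi `|X w|].
have G0 x : 0 <= G x by exact: (Vr_ge0 hS).
have Ga x y : x <= y -> G y <= G x.
  by move=> xy; apply: (Vr_mono hS) => w /=; exact: le_lt_trans.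
have GA s : G (A s) = tailF (t s).
  rewrite /G /tailF; congr Vr; apply/seteqP; split => w /=; rewrite phi_lt// ?ltW//.
have ainc k : a k <= a k.+1 by case: k => [|k] /=; [exact: ltW|exact: AS].
have ainf x : exists k, x < a k.
  have c0 : 0 < (1 - l) * A 0%N by rewrite mulr_gt0 ?subr_gt0.
  (* Since [A s <= l * A s.+1], each increment is at least [(1 - l) * A 0], so the mesh exhausts the
     half-line. *)
  have step s : A 0%N <= A s /\ s%:R * ((1 - l) * A 0%N) <= A s.
    elim: s => [|s [IH1 IH2]]; first by split=> //; rewrite mul0r ltW.
    have h1 : A s <= l * A s.+1 := hl s.
    split; first exact: le_trans IH1 (AS s).
    rewrite -nat1r mulrDl mul1r.
    have h2 : (1 - l) * A 0%N <= (1 - l) * A s.+1.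
      by rewrite ler_wpM2l ?subr_ge0 ?(ltW l1)// (le_trans IH1).
    lra.
  exists (Num.truncn (x / ((1 - l) * A 0%N))).+2 => /=.
  apply: lt_le_trans (step _).2; rewrite -ltr_pdivrMr//.
  exact: truncnS_gt.
have [P hP] := choice (fun k => integral_antitone_itv G0 Ga (ainc k)).
have P0 k : 0 <= P k.
  by have [_ [h _]] := hP k; apply: le_trans h; rewrite mulr_ge0// subr_ge0.
rewrite choquet_ge0; last by move=> w; exact: phi0.
rewrite (integral_antitone_series G0 Ga (a := a))//.
rewrite (eq_eseriesr (fun k _ => (hP k).1)) nneseries0_bsum//.
have w0 s : 0 <= weighted tailF p D (fun s => phi (D * tw (s%:R * p))) s.
  by rewrite mulr_ge0 ?tailF_ge0// ltW// A0.
rewrite -[in X in X <-> _]bsum_shift//; split=> h.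
  apply/bsum_shift => //.
  (* The lower Riemann term carries [A s.+1 - A s], which is at least [(1 - l) * A s.+1]. *)
  have il : 0 <= (1 - l)^-1 by rewrite invr_ge0 subr_ge0 ltW.
  apply: (bsum_le il) h => s; rewrite /weighted -/(t _) -/(A _).
  have [_ [h1 _]] := hP s.+1; rewrite /= GA in h1.
  rewrite ler_pdivlMl ?subr_gt0// mulrA; apply: le_trans h1.
  rewrite ler_wpM2r ?tailF_ge0//; have := hl s; rewrite -/(t _) -/(t _) -/(A _) -/(A _).
  lra.
apply: (bsum_le L0) h => s; rewrite /weighted -/(t _) -/(A _).
have [_ [_ h2]] := hP s.+1; rewrite /= GA in h2; apply: le_trans h2 _.
rewrite mulrA ler_wpM2r ?tailF_ge0//.
by have := hL s; have := A0 s; rewrite -/(t _) -/(t _) -/(A _) -/(A _); lra.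
Qed.

(* [1 + \sum_s 2 ^ ((s + 1) p q) 1_{|X| > 2 ^ (s p)}] dominates [|X| ^ q]; countable
   sub-additivity gives a bound for all [Y <= |X| ^ q] at once, as
   [|X| ^ q] itself need not belong to [H] when [q < 1]. *)
Lemma E_le_moment (p q : R) : H X -> 0 < p -> 0 < q ->
  bsum (weighted tailF p 1 (fun s => tw (s%:R * (p * q)))) ->
  exists K : R, 0 < K /\ forall Y, H Y -> (forall w, 0 <= Y w) ->
    (forall w, Y w <= `|X w| `^ q) -> (E Y <= K%:E)%E.
Proof.
move=> HX p0 q0 hb.
have HaX : H (fun w => `|X w|) by exact: (H_norm hS).
pose c s : R := tw (s.+1%:R * (p * q)).
have c0 s : 0 <= c s by exact: tw_ge0.
pose Xn k (w : Omega) : R := if k is s.+1 then c s * \1_[set w | tw (s%:R * p) < `|X w|] w else 1.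
have mT s : measurable [set w | tw (s%:R * p) < `|X w|].
  exact: (measurable_set_gt hS).
have bXn k : bdH H (Xn k).
  case: k => [|s]; first exact: (bdH_cst hS).
  by apply: (bdH_scale hS); exact: (bdH_indic hS).
pose u k : R := if k is s.+1 then c s * tailF (tw (s%:R * p)) else 1.
have EXn k : E (Xn k) = (u k)%:E.
  rewrite (E_bdH hS (bXn k)); congr EFin; case: k => [|s]; first exact: (Er_cst hS).
  rewrite /Xn /u (Er_scale hS)//; last exact: (bdH_indic hS).
  by rewrite /tailF (Vr_indic hS).
have u0 k : 0 <= u k by case: k => [|s]//; rewrite mulr_ge0 ?tailF_ge0.
have bu : bsum u.
  apply/bsum_shift => //; apply: (bsum_le (tw_ge0 (p * q))) hb => s.
  have e : c s = tw (p * q) * tw (s%:R * (p * q)) by rewrite /c -twD -nat1r mulrDl mul1r.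
  by rewrite /weighted /= mul1r [X in _ <= X]mulrA -e.
have [B hB] := bu.
exists (`|B| + 1); split; first by rewrite ltr_wpDl.
move=> Y HY Y0 YX.
apply: (@le_trans _ _ (\sum_(0 <= k <oo) E (Xn k))%E).
  apply: (E_countable hS) => //.
  - by move=> k; case: (bXn k).
  - case=> [|s] w //=; rewrite mulr_ge0// indicE; by case: (_ \in _).
  have Xn0 k w : 0 <= Xn k w.
    by case: k => [|s] //=; rewrite mulr_ge0// indicE; case: (_ \in _).
  move=> w; have h k : ((Xn k w)%:E <= \sum_(0 <= k <oo) (Xn k w)%:E)%E.
    apply: le_trans (nneseries_lim_ge k.+1 _); last by move=> n _ _; rewrite lee_fin.
    rewrite sumEFin lee_fin big_nat_recr//= lerDr.
    exact: sumr_ge0.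
  have [X1|X1] := leP `|X w| 1.
    apply: le_trans (h 0%N); rewrite lee_fin; apply: le_trans (YX w) _.
    apply: (@le_trans _ _ (1 `^ q)); last by rewrite powR1.
    by apply: ge0_ler_powR; rewrite ?nnegrE// ltW.
  (* The least such [s] has [2 ^ (s p) < |X w| <= 2 ^ ((s + 1) p)], so the single term of index
     [s + 1] already dominates [|X w| ^ q]. *)
  have ex : exists s, `|X w| <= tw (s.+1%:R * p).
    exists (Num.truncn (`|X w| / (p * ln 2))).
    apply: le_trans (tw_ge_lin _); rewrite -mulrA -ler_pdivrMr ?mulr_gt0 ?ln_gt0 ?ltr1n//.
    exact: ltW (truncnS_gt _).
  have [s hs smin] := ex_minnP ex.
  apply: le_trans (h s.+1); rewrite lee_fin; apply: le_trans (YX w) _.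
  have hs' : tw (s%:R * p) < `|X w|.
    case: s hs smin => [|s] hs smin; first by rewrite mul0r tw0.
    rewrite ltNge; apply/negP => /smin; by rewrite ltnn.
  rewrite /= indicE mem_set// mulr1 /c mulrA twM.
  by rewrite ge0_ler_powR ?nnegrE ?tw_ge0// ltW.
rewrite (eq_eseriesr (fun k _ => EXn k)).
apply: (@le_trans _ _ B%:E); last by rewrite lee_fin ler_wpDr// ler_norm.
apply: lime_le; first by apply: is_cvg_nneseries => n _ _; rewrite lee_fin.
by apply: nearW => N; rewrite sumEFin lee_fin.
Qed.

End Choquet.

(** * Truncation and the weights *)

Section Truncation.
Set Implicit Arguments. Unset Strict Implicit. Unset Printing Implicit Defensive.
Context {R : realType}.
Implicit Types (x y q : R).

Definition clip (eta y : R) : R := Num.max (- eta) (Num.min eta y).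

Lemma clip_id eta y : `|y| <= eta -> clip eta y = y.
Proof. by rewrite ler_norml => /andP[h1 h2]; rewrite /clip min_r// max_r. Qed.

Lemma clip_norm eta y : 0 <= eta -> `|clip eta y| <= eta.
Proof.
move=> e0; rewrite ler_norml /clip le_max lexx/= ge_max ge_min lexx/=.
by rewrite andbT; lra.
Qed.

Lemma clip_le_norm eta y : 0 <= eta -> `|clip eta y| <= `|y|.
Proof.
move=> e0; have [h|h] := leP `|y| eta; first by rewrite clip_id.
exact: le_trans (clip_norm y e0) (ltW h).
Qed.

Lemma clip_powR eta y m q : 0 < eta -> 0 < q -> q <= m ->
  `|clip eta y| `^ m <= eta `^ (m - q) * `|y| `^ q.
Proof.
move=> e0 q0 qm; have -> : m = (m - q) + q by rewrite subrK.
rewrite powRD; last by rewrite subrK (gt_eqF (lt_le_trans q0 qm)).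
rewrite subrK; apply: ler_pM; rewrite ?powR_ge0//.
  apply: ge0_ler_powR; rewrite ?nnegrE ?subr_ge0 ?normr_ge0 ?(ltW e0)//.
  exact: clip_norm (ltW e0).
apply: ge0_ler_powR; rewrite ?nnegrE ?normr_ge0 ?(ltW q0)//.
exact: clip_le_norm (ltW e0).
Qed.

(** The difference vanishes unless [|y| > eta], and then [|y| = |y| ^ (1 - q) * |y| ^ q] with
    [1 - q <= 0]. *)
Lemma clip_tail eta y q : 0 < eta -> 1 <= q ->
  `|y - clip eta y| <= eta `^ (1 - q) * `|y| `^ q.
Proof.
move=> e0 q1; have q0 : 0 < q by apply: lt_le_trans q1.
have [h|h] := leP `|y| eta.
  by rewrite clip_id// subrr normr0 mulr_ge0 ?powR_ge0.
apply: (@le_trans _ _ `|y|).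
  have : y < - eta \/ eta < y.
    case: (ltP y 0) => y0; [left|right]; first by rewrite ltrNr; move: h; rewrite ltr0_norm.
    by move: h; rewrite ger0_norm.
  rewrite /clip => -[hy|hy].
    rewrite min_r; last lra.
    rewrite max_l; last exact: ltW.
    by rewrite !ltr0_norm; lra.
  rewrite min_l; last exact: ltW.
  rewrite max_r; last lra.
  by rewrite !gtr0_norm; lra.
have y0 : 0 < `|y| by exact: lt_trans h.
rewrite -ler_pdivrMr ?powR_gt0//.
have -> : `|y| / `|y| `^ q = (`|y| `^ (q - 1))^-1.
  rewrite -{1}(powRr1 (ltW y0)) -!powRN -powRD; last by rewrite (gt_eqF y0) implybT.
  by congr (_ `^ _); lra.
have -> : eta `^ (1 - q) = (eta `^ (q - 1))^-1 by rewrite -powRN opprB.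
rewrite lef_pV2 ?posrE ?powR_gt0// ge0_ler_powR ?nnegrE ?subr_ge0// ltW//.
Qed.

Lemma measurable_clip eta : measurable_fun setT (clip eta).
Proof. by apply: measurable_maxr => //; exact: measurable_minr. Qed.

(** Only [1 + y <= expR y] is used. For [x >= 0], taking [y = - x] gives [expR x - 1 <= x * expR x],
    whence [expR x - 1 - x <= x * (expR x - 1) <= x ^+ 2 * expR x]. *)
Lemma expR_quadratic x : expR x <= 1 + x + x ^+ 2 * expR `|x|.
Proof.
have h1 := expR_ge1Dx x; have h2 := expR_ge1Dx (- x).
have e0 := expR_gt0 x; rewrite expRN in h2.
have [x0|x0] := leP 0 x.
  rewrite ger0_norm//; set e := expR x in h1 h2 e0 *.
  have : (1 - x) * e <= 1 by rewrite -ler_pdivlMr// mul1r.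
  nra.
rewrite ltr0_norm// expRN; set e := expR x in h1 h2 e0 *.
have ee : e * e^-1 = 1 by rewrite divff// gt_eqF.
have i0 : 0 < e^-1 by rewrite invr_gt0.
set f := e^-1 in h2 ee i0 *.
have h3 : (1 - x) * e <= f * e by rewrite ler_wpM2r// ltW.
have f1 : 1 <= f by lra.
rewrite [f * e]mulrC ee in h3.
have : e - 1 - x <= x ^+ 2 by nra.
have : 0 <= x ^+ 2 * (f - 1) by rewrite mulr_ge0 ?sqr_ge0 ?subr_ge0.
lra.
Qed.

Lemma ln_le_powR x s : 1 <= x -> 0 < s -> ln x <= s^-1 * x `^ s.
Proof.
move=> x1 s0; have x0 : 0 < x by apply: lt_le_trans x1.
rewrite ler_pdivlMl// /powR gt_eqF//.
by have := expR_ge1Dx (s * ln x); lra.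
Qed.

End Truncation.

Section Weights.
Set Implicit Arguments. Unset Strict Implicit. Unset Printing Implicit Defensive.
Context {R : realType} (p beta : R).

Definition scale (n k : nat) : R := n%:R `^ (p + beta) * k%:R `^ (- beta).

Lemma scale_gt0 n k : (0 < n)%N -> (0 < k)%N -> 0 < scale n k.
Proof. by move=> n0 k0; rewrite mulr_gt0// powR_gt0// ltr0n. Qed.

Lemma invr_powR (x s : R) : 0 < x -> x^-1 `^ s = (x `^ s)^-1.
Proof. by move=> x0; rewrite -powR_inv1 ?ltW// -powRrM mulN1r powRN. Qed.

Lemma weight_scale n k : (0 < n)%N -> (0 < k)%N ->
  (k%:R / n%:R) `^ beta * (1 / n%:R) `^ p = (scale n k)^-1.
Proof.
move=> n0 k0; have n0' : (0 : R) < n%:R by rewrite ltr0n.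
have k0' : (0 : R) < k%:R by rewrite ltr0n.
rewrite mul1r powRM ?invr_ge0 ?ltW// !invr_powR// /scale invfM.
rewrite [k%:R `^ (- beta)]powRN invrK [RHS]mulrC -mulrA; congr (_ * _).
by rewrite -invfM -powRD ?(gt_eqF n0') ?implybT// addrC.
Qed.

(** The weight is [n ^ (- p) * (n / k) ^ (- beta)] with [n / k >= 1], so the exponent [- beta] may
    be raised to any larger [b]; [sum_scale_powR] takes [b q > 1] to make the sum over [k]
    converge. *)
Lemma scale_inv_le n k (b : R) : (0 < k)%N -> (k <= n)%N -> - beta <= b ->
  (scale n k)^-1 <= n%:R `^ (b - p) * k%:R `^ (- b).
Proof.
move=> k0 kn bb; have n0 : (0 < n)%N by exact: leq_trans kn.
have n0' : (0 : R) < n%:R by rewrite ltr0n.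
have k0' : (0 : R) < k%:R by rewrite ltr0n.
rewrite -weight_scale// mul1r.
have -> : n%:R `^ (b - p) * k%:R `^ (- b) = (n%:R / k%:R) `^ b * n%:R^-1 `^ p.
  rewrite powRM ?invr_ge0 ?ltW// !invr_powR// powRN powRB; last by rewrite (gt_eqF n0') implybT.
  by rewrite -!mulrA; congr (_ * _); rewrite mulrC.
rewrite ler_wpM2r ?powR_ge0//.
have -> : k%:R / n%:R = (n%:R / k%:R)^-1 :> R by rewrite invf_div.
rewrite invr_powR ?divr_gt0// -powRN ler_powR//.
by rewrite ler_pdivlMr// mul1r ler_nat.
Qed.

Lemma sum_scale_powR (b q : R) : 0 < q -> - beta <= b -> 1 < b * q ->
  exists B : R, 0 < B /\ forall n, (0 < n)%N ->
    \sum_(1 <= k < n) (scale n k)^-1 `^ q <= B * n%:R `^ (- (q * (p - b))).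
Proof.
move=> q0 bb bq; have bq' : - (b * q) < -1 :> R by rewrite ltrN2.
have [B [B0 hB]] : exists B : R, 0 < B /\ forall n, \sum_(1 <= k < n) k%:R `^ (- (b * q)) <= B.
  have [B hB] := bsum_powR bq'; exists (`|B| + 1); split; first by rewrite ltr_wpDl.
  move=> n; apply: le_trans (_ : B <= _); last by rewrite ler_wpDr// ler_norm.
  apply: le_trans (hB n); case: n => [|n]; first by rewrite !big_geq.
  rewrite [X in _ <= X]big_ltn// add0r; apply: ler_sum_nat => k /andP[k0 _].
  by case: k k0.
exists B; split=> // n n0; rewrite mulrC.
apply: le_trans (ler_wpM2l (powR_ge0 _ _) (hB n)).
rewrite mulr_sumr; apply: ler_sum_nat => k /andP[k0 kn].
apply: (@le_trans _ _ ((n%:R `^ (b - p) * k%:R `^ (- b)) `^ q)).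
  apply: ge0_ler_powR; rewrite ?nnegrE ?(ltW q0) ?mulr_ge0 ?powR_ge0//.
    by rewrite invr_ge0 ltW// scale_gt0.
  by apply: scale_inv_le => //; exact: ltnW.
rewrite powRM ?powR_ge0// -!powRrM mulNr.
by have -> : (b - p) * q = - (q * (p - b)) by ring.
Qed.

End Weights.

(** * Partial sums *)

Section PartialSums.
Set Implicit Arguments. Unset Strict Implicit. Unset Printing Implicit Defensive.
Context {d : measure_display} {Omega : measurableType d} {R : realType}.
Context (H : set (Omega -> R)) (E : (Omega -> R) -> \bar R).
Context (hS : sublinear_space H E).
Context (Xs : nat -> Omega -> R) (X : Omega -> R).
Context (HX : H X) (HXs : forall k, H (Xs k)).
Context (hind : forall n : nat, (0 < n)%N -> indep H E (fun i : 'I_n => Xs i) (Xs n)).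
Context (hid : forall k, ident_distr H E (Xs k) X).

Local Notation V := (Vr H E).
Local Notation bdH := (bdH H).
Local Notation Er := (Er E).
Local Notation F := (tailF H E X).

(** Indices are shifted by one: [b i] and [Xs i] stand for the weight and the variable of index
    [i + 1], so that at most [n - 1] terms are summed. *)
Definition exceed (b : nat -> R) (n : nat) (eps : R) : set Omega :=
  [set w | exists j, (j < n)%N /\ eps < `|\sum_(0 <= i < j) b i * Xs i w|].

Lemma exceed_ge (b : nat -> R) n eps (c : nat -> R) :
  (forall k, (k < n)%N -> 0 < b k /\ 2 * eps <= b k * c k) ->
  1 - expR (- \sum_(0 <= k < n) F (c k)) <= V (exceed b n.+1 eps).
Proof.
move=> hb; apply: le_trans (V_union_ge hS HX HXs hind hid c n) _.
apply: (Vr_mono hS) => w /= [k [kn hk]]; have [b0 bc] := hb k kn.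
have hx : 2 * eps < `|b k * Xs k w|.
  by rewrite normrM (gtr0_norm b0); apply: le_lt_trans bc _; rewrite ltr_pM2l.
have e : b k * Xs k w = \sum_(0 <= i < k.+1) b i * Xs i w - \sum_(0 <= i < k) b i * Xs i w.
  by rewrite big_nat_recr//= addrAC subrr add0r.
have [h|h] := ltP eps `|\sum_(0 <= i < k) b i * Xs i w|.
  by exists k; split=> //; rewrite ltnW.
exists k.+1; split=> //; move: hx; rewrite e => hx.
by have := ler_normB (\sum_(0 <= i < k.+1) b i * Xs i w) (\sum_(0 <= i < k) b i * Xs i w); lra.
Qed.

Lemma measurable_exists (A : nat -> set Omega) n : (forall i, measurable (A i)) ->
  measurable [set w | exists i, (i < n)%N /\ A i w].
Proof.
move=> mA; rewrite (_ : [set w | _] = \bigcup_(i in `I_n) A i).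
  by apply: bigcup_measurable => i _.
by apply/seteqP; split => w [i]; [case=> a b; exists i|move=> a b; exists i].
Qed.

Context (eta : R) (eta0 : 0 < eta).

Let T (b : R) (x : R) : R := clip eta (b * x).

Let mT b : measurable_fun setT (T b).
Proof. by apply: (measurableT_comp (measurable_clip eta)); exact: measurable_funM. Qed.

Let HT b Y : H Y -> H (T b \o Y).
Proof.
move=> HY; apply: (H_max hS); first exact: (H_cst hS).
by apply: (H_min hS); [exact: (H_cst hS)|exact: (H_scale hS)].
Qed.

Let bdT b Y : H Y -> bdH (T b \o Y).
Proof.
move=> HY; split; first exact: HT.
by exists eta => w; exact: clip_norm (ltW eta0).
Qed.

Section Moments.
Context (K q : R) (K0 : 0 < K) (q0 : 0 < q).
Context (hK : forall Y, H Y -> (forall w, 0 <= Y w) ->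
  (forall w, Y w <= `|X w| `^ q) -> (E Y <= K%:E)%E).

Let scaled_moment Y (c : R) : 0 < c -> H Y -> (forall w, 0 <= Y w) ->
  (forall w, Y w <= c * `|X w| `^ q) -> (E Y <= (c * K)%:E)%E.
Proof.
move=> c0 HY Y0 YX.
have -> : Y = (fun w => c * (c^-1 * Y w)).
  by apply/funext => w; rewrite mulrA divff ?mul1r// gt_eqF.
have HY' : H (fun w => c^-1 * Y w) by exact: (H_scale hS).
rewrite (E_scale hS)//; last exact: ltW.
rewrite EFinM lee_wpmul2l ?lee_fin ?(ltW c0)//.
apply: hK => // w; first by rewrite mulr_ge0// invr_ge0 ltW.
by rewrite ler_pdivrMl.
Qed.

Let powN b x : 0 < b -> `|b * x| `^ q = b `^ q * `|x| `^ q.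
Proof. by move=> b0; rewrite normrM powRM// gtr0_norm. Qed.

Lemma second_moment_clip k b : 0 < b -> q <= 2 ->
  Er (fun w => T b (Xs k w) ^+ 2) <= eta `^ (2 - q) * b `^ q * K.
Proof.
move=> b0 q2; have m2 : measurable_fun setT (fun x => T b x ^+ 2) by exact: measurable_funX.
have bd Y : H Y -> bdH ((fun x => T b x ^+ 2) \o Y).
  by move=> HY; exact: (bdH_mul hS (bdT b HY) (bdT b HY)).
rewrite (Er_ident hS hid (k := k) m2 (bd _ (HXs k)) (bd _ HX)).
rewrite -lee_fin -(E_bdH hS (bd _ HX)).
apply: scaled_moment; first by rewrite mulr_gt0// powR_gt0.
- by case: (bd _ HX).
- by move=> w; exact: sqr_ge0.
move=> w /=; rewrite -mulrA -powN// -real_normK ?num_real// -powR_mulrn//.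
exact: clip_powR.
Qed.

(** For [q <= 1] the truncation is bounded in absolute value. For [q >= 1] it is compared with
    [b * X], whose expectation is 0 with either sign, so only the part cut off by [clip] remains.
    The sign [s] is there because [E] is not linear. *)
Lemma mean_clip k b (s : bool) : 0 < b ->
  (q <= 1 \/ 1 <= q /\ E X = 0%E /\ E (fun w => - X w) = 0%E) ->
  Er (fun w => (-1) ^+ s * T b (Xs k w)) <= eta `^ (1 - q) * b `^ q * K.
Proof.
move=> b0 hq; have m1 : measurable_fun setT (fun x => (-1) ^+ s * T b x : R).
  by apply: measurable_funM => //; exact: mT.
have bd Y : H Y -> bdH ((fun x => (-1) ^+ s * T b x) \o Y).
  by move=> HY; exact: (bdH_scale hS _ (bdT b HY)).
rewrite (Er_ident hS hid (k := k) m1 (bd _ (HXs k)) (bd _ HX)).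
rewrite -lee_fin -(E_bdH hS (bd _ HX)).
have c0 : 0 < eta `^ (1 - q) * b `^ q by rewrite mulr_gt0// powR_gt0.
have sgn (y : R) : (-1) ^+ s * y <= `|y|.
  by case: (s); rewrite ?expr1 ?expr0 ?mulN1r ?mul1r ?ler_norm// -normrN ler_norm.
case: hq => [q1|[q1 [EX ENX]]].
  apply: (@le_trans _ _ (E (fun w => `|T b (X w)|))).
    apply: (E_mono hS); [by case: (bd _ HX)|exact: (H_norm hS (HT b HX))|].
    by move=> w /=; exact: sgn.
  apply: scaled_moment => //; first exact: (H_norm hS (HT b HX)).
  move=> w; rewrite -mulrA -powN// -[X in X <= _](powRr1 (normr_ge0 _)).
  exact: clip_powR.
pose Y1 w : R := (-1) ^+ s * (b * X w); pose Y2 w : R := `|b * X w - T b (X w)|.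
have HbX : H (fun w => b * X w) by exact: (H_scale hS).
have HY1 : H Y1 by exact: (H_scale hS).
have HY2 : H Y2.
  by apply: (H_norm hS); apply: (H_add hS) => //; exact: (H_opp hS (HT b HX)).
have EY1 : E Y1 = 0%E.
  rewrite /Y1; case: (s) => /=.
    under eq_fun do rewrite expr1 mulN1r -mulrN.
    by rewrite (E_scale hS (H_opp hS HX) (ltW b0)) ENX mule0.
  under eq_fun do rewrite expr0 mul1r.
  by rewrite (E_scale hS HX (ltW b0)) EX mule0.
have EY2 : (E Y2 <= (eta `^ (1 - q) * b `^ q * K)%:E)%E.
  apply: scaled_moment => // w; first exact: normr_ge0.
  by rewrite -mulrA -powN//; exact: clip_tail.
have EY2' : (0 <= E Y2)%E.
  by apply: (@le_trans _ _ (E (fun=> 0))); [rewrite (E_cst hS)|apply: (E_mono hS) => //; [exact: (H_cst hS)|move=> w; exact: normr_ge0]].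
apply: (@le_trans _ _ (E (fun w => Y1 w + Y2 w))).
  apply: (E_mono hS); [by case: (bd _ HX)|exact: (H_add hS)|].
  move=> w /=; rewrite /Y1 /Y2 -lerBlDl -mulrBr distrC.
  exact: sgn.
apply: le_trans (E_subadd hS HY1 HY2 _ _) _; rewrite ?EY1 ?add0e//.
- by case.
- by case.
Qed.

End Moments.

(* Off the event that some [`|b k X_k|] exceeds [eta], the sums are those of
   the truncated variables, to which [ville] applies with quadratic majorants
   [1 + y + y ^+ 2 * expR (t * eta)] of [expR y], [y = +- t * T (b k) x]. *)
Lemma ville_clip (b : nat -> R) n (eps t : R) (s : bool) (m v : nat -> R) : 0 < t -> 0 < eps ->
  (forall k, (k < n)%N -> 0 <= m k /\ 0 <= v k) ->
  (forall k, (k < n)%N -> Er (fun w => (-1) ^+ s * T (b k) (Xs k w)) <= m k) ->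
  (forall k, (k < n)%N -> Er (fun w => T (b k) (Xs k w) ^+ 2) <= v k) ->
  V [set w | exists j, (j <= n)%N /\ eps < \sum_(0 <= i < j) (-1) ^+ s * T (b i) (Xs i w)] <=
  expR (- (t * eps)) * expR (\sum_(0 <= k < n) (t * m k + t ^+ 2 * expR (t * eta) * v k)).
Proof.
move=> t0 eps0 mv0 hm hv.
pose M := t ^+ 2 * expR (t * eta).
have M0 : 0 <= M by rewrite mulr_ge0 ?sqr_ge0 ?expR_ge0.
pose g k (x : R) : R := 1 + t * ((-1) ^+ s * T (b k) x) + M * T (b k) x ^+ 2.
have mg k : measurable_fun setT (g k).
  apply: measurable_funD.
    by apply: measurable_funD => //; apply: measurable_funM => //; apply: measurable_funM.
  by apply: measurable_funM => //; exact: measurable_funX.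
have s2 : ((-1) ^+ s : R) ^+ 2 = 1 by rewrite -exprM mulnC exprM sqrrN !expr1n.
have expg k x : expR (t * ((-1) ^+ s * T (b k) x)) <= g k x.
  apply: le_trans (expR_quadratic _) _; rewrite /g lerD2l.
  rewrite !exprMn s2 mul1r /M mulrAC ler_wpM2r ?sqr_ge0// ler_wpM2l ?sqr_ge0//.
  rewrite ler_expR !normrM normrX normrN1 expr1n mul1r (gtr0_norm t0) ler_pM2l//.
  exact: clip_norm (ltW eta0).
have g0 k x : 0 <= g k x by apply: le_trans (expg k x); exact: expR_ge0.
have bT k : bdH (T (b k) \o Xs k) by exact: bdT.
have bsT k : bdH (fun w => (-1) ^+ s * T (b k) (Xs k w)) by exact: (bdH_scale hS _ (bT k)).
have bT2 k : bdH (fun w => T (b k) (Xs k w) ^+ 2) by exact: (bdH_mul hS (bT k) (bT k)).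
have b1 k : bdH (fun w => t * ((-1) ^+ s * T (b k) (Xs k w)) + M * T (b k) (Xs k w) ^+ 2).
  by apply: (bdH_add hS); exact: (bdH_scale hS).
have gE k : g k \o Xs k = (fun w => 1 + (t * ((-1) ^+ s * T (b k) (Xs k w)) + M * T (b k) (Xs k w) ^+ 2)).
  by apply/funext => w; rewrite /g/= addrA.
have bg k : bdH (g k \o Xs k) by rewrite gE; apply: (bdH_add hS) => //; exact: (bdH_cst hS).
pose lam := expR (t * eps).
have lam1 : 1 <= lam by rewrite -expR0 ler_expR mulr_ge0// ltW.
have := ville hS hind mg g0 bg lam1 n; rewrite /lam -expRN => hV.
apply: le_trans (le_trans _ hV) _.
  apply: (Vr_mono hS) => w /= [j [jn hj]]; exists j; split=> //.
  apply: (@lt_le_trans _ _ (\prod_(0 <= k < j) expR (t * ((-1) ^+ s * T (b k) (Xs k w))))).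
    by rewrite -expR_sum -mulr_sumr ltr_expR ltr_pM2l.
  by apply: ler_prod => k _; rewrite expR_ge0 expg.
rewrite ler_wpM2l ?expR_ge0// expR_sum big_nat [X in _ <= X]big_nat.
apply: ler_prod => k /andP[_ kn]; rewrite le_max ler01/=.
have [m0 v0] := mv0 k kn.
have tm0 : 0 <= t * m k by rewrite mulr_ge0// ltW.
have Mv0 : 0 <= M * v k by rewrite mulr_ge0.
apply: le_trans (expR_ge1Dx _); rewrite ge_max -/M; apply/andP; split; first by lra.
rewrite gE (Er_translate hS)// lerD2l.
apply: le_trans (Er_add hS _ _) _; try exact: (bdH_scale hS).
rewrite (Er_scale hS (bsT k) (ltW t0)) (Er_scale hS (bT2 k) M0).
by apply: lerD; [rewrite ler_wpM2l ?hm// ltW|rewrite ler_wpM2l ?hv].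
Qed.

Lemma exceed_le_clip (b : nat -> R) n (eps t : R) (m v : nat -> R) : 0 < t -> 0 < eps ->
  (forall k, (k < n)%N -> [/\ 0 < b k, 0 <= m k & 0 <= v k]) ->
  (forall k s, (k < n)%N -> Er (fun w => (-1) ^+ nat_of_bool s * T (b k) (Xs k w)) <= m k) ->
  (forall k, (k < n)%N -> Er (fun w => T (b k) (Xs k w) ^+ 2) <= v k) ->
  V (exceed b n.+1 eps) <= \sum_(0 <= k < n) F (eta / b k) +
  2 * (expR (- (t * eps)) * expR (\sum_(0 <= k < n) (t * m k + t ^+ 2 * expR (t * eta) * v k))).
Proof.
move=> t0 eps0 mv0 hm hv.
pose A k := [set w | eta / b k < `|Xs k w|].
pose S (s : bool) j w := \sum_(0 <= i < j) (-1) ^+ s * T (b i) (Xs i w).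
pose B s := [set w | exists j, (j <= n)%N /\ eps < S s j w].
have mA k : measurable (A k) by apply: (measurable_set_gt hS); exact: (H_norm hS).
have HSs s j : H (S s j).
  elim: j => [|j IH].
    suff -> : S s 0%N = (fun=> 0) by exact: (H_cst hS).
    by apply/funext => w; rewrite /S big_geq.
  suff -> : S s j.+1 = (fun w => S s j w + (-1) ^+ s * T (b j) (Xs j w)).
    by apply: (H_add hS) => //; apply: (H_scale hS); exact: HT.
  by apply/funext => w; rewrite /S big_nat_recr.
have mB s : measurable (B s).
  have mS j : measurable [set w | eps < S s j w] by exact: (measurable_set_gt hS).
  exact: (measurable_exists n.+1 mS).
have mA' : measurable [set w | exists k, (k < n)%N /\ A k w] by exact: measurable_exists.
apply: (@le_trans _ _ (V ([set w | exists k, (k < n)%N /\ A k w] `|` (B false `|` B true)))).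
  apply: (Vr_mono hS) => w [j [jn hj]].
  have [hA|hA] := pselect (exists k, (k < n)%N /\ A k w); first by left.
  right; have hT k : (k < n)%N -> T (b k) (Xs k w) = b k * Xs k w.
    move=> kn; have [b0 _ _] := mv0 k kn; apply: clip_id; rewrite leNgt; apply/negP => h.
    apply: hA; exists k; split=> //; rewrite /A/= ltr_pdivrMr// mulrC.
    by rewrite -[X in X * _](gtr0_norm b0) -normrM.
  have hSs s : S s j w = (-1) ^+ s * \sum_(0 <= i < j) b i * Xs i w.
    rewrite mulr_sumr; apply: eq_big_nat => i /andP[_ ij].
    by rewrite hT// (leq_trans ij).
  have [h|h] := leP 0 (\sum_(0 <= i < j) b i * Xs i w).
    by left; exists j; split=> //; rewrite hSs expr0 mul1r; move: hj; rewrite ger0_norm.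
  by right; exists j; split=> //; rewrite hSs expr1 mulN1r; move: hj; rewrite ltr0_norm.
apply: le_trans (Vr_subadd hS mA' (measurableU _ _ (mB _) (mB _))) _.
apply: lerD.
  apply: le_trans (Vr_bigU hS n mA) _; apply: ler_sum => k _.
  by rewrite /A /tailF (V_abs_gt hS HX HXs hid).
apply: le_trans (Vr_subadd hS (mB _) (mB _)) _.
have hB s : V (B s) <= expR (- (t * eps)) * expR (\sum_(0 <= k < n) (t * m k + t ^+ 2 * expR (t * eta) * v k)).
  apply: ville_clip => // k kn; last exact: hm.
  by have [] := mv0 k kn.
by have h1 := hB false; have h2 := hB true; lra.
Qed.

End PartialSums.

(** * Choquet moments as dyadic series *)

Section MomentConditions.
Set Implicit Arguments. Unset Strict Implicit. Unset Printing Implicit Defensive.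
Context {d : measure_display} {Omega : measurableType d} {R : realType}.
Context (H : set (Omega -> R)) (E : (Omega -> R) -> \bar R).
Context (hS : sublinear_space H E) (X : Omega -> R).
Local Notation F := (tailF H E X).
Local Notation C_V := (choquetE (capV H E)).

Lemma ltr_mono_nneg (phi : R -> R) : (forall a b, 0 <= a -> a < b -> phi a < phi b) ->
  forall a b, 0 <= a -> 0 <= b -> (phi a < phi b) = (a < b).
Proof.
move=> h a b a0 b0; case: (ltgtP a b) => [ab|ba|->]; last by rewrite ltxx.
- by rewrite h.
- by apply/negbTE; rewrite -leNgt ltW// h.
Qed.

Lemma powR_lt (k a b : R) : 0 < k -> 0 <= a -> a < b -> a `^ k < b `^ k.
Proof.
move=> k0 a0 ab; apply: gt0_ltr_powR => //; rewrite nnegrE//.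
by apply: ltW; exact: le_lt_trans ab.
Qed.

Lemma powR_mesh (k p D : R) s : 0 < D ->
  (D * tw (s%:R * p)) `^ k = D `^ k * tw (s%:R * (p * k)).
Proof. by move=> D0; rewrite powRM ?tw_ge0 ?(ltW D0)// -twM mulrA. Qed.

(** The left side does not involve [D]: the series converges for one [D > 0] exactly when it does
    for all. *)
Lemma choquet_powR (k p D : R) : 0 < k -> 0 < p -> 0 < D ->
  (C_V (fun w => `|X w| `^ k)%R < +oo)%E <->
  bsum (weighted F p D (fun s => tw (s%:R * (p * k)))).
Proof.
move=> k0 p0 D0; have Dk : 0 < D `^ k by rewrite powR_gt0.
have pk : 0 < p * k by rewrite mulr_gt0.
rewrite (choquet_bsum hS X (phi := fun x => x `^ k) (p := p) (D := D)
  (l := tw (- (p * k))) (L := tw (p * k))) ?tw_ge0//.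
- split=> [|] h.
    apply: (bsum_le (C := (D `^ k)^-1)) h => [|s]; first by rewrite invr_ge0 ltW.
    by rewrite /weighted powR_mesh// !mulrA mulVf ?mul1r// gt_eqF.
  apply: (bsum_le (ltW Dk)) h => s.
  by rewrite /weighted powR_mesh// -[X in X <= _]mulrA.
- by apply: ltr_mono_nneg => a b; exact: powR_lt.
- by move=> a _; exact: powR_ge0.
- by rewrite tw_lt1// oppr_lt0.
- move=> s; rewrite !powR_mesh// [X in _ <= X]mulrCA -twD ler_wpM2l ?(ltW Dk)// tw_le//.
  by rewrite -nat1r; lra.
- move=> s; rewrite !powR_mesh// [X in _ <= X]mulrCA -twD ler_wpM2l ?(ltW Dk)// tw_le//.
  by rewrite -nat1r; lra.
Qed.

Lemma ln_tw (x : R) : ln (tw x) = x * ln 2.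
Proof. by rewrite /tw ln_powR. Qed.

Lemma choquet_powR_ln (k p D : R) : 0 < k -> 0 < p -> 0 < D ->
  (C_V (fun w => `|X w| `^ k * ln (1 + `|X w|))%R < +oo)%E <->
  bsum (weighted F p D (fun s => tw (s%:R * (p * k)) * s.+1%:R)).
Proof.
move=> k0 p0 D0; have Dk : 0 < D `^ k by rewrite powR_gt0.
have pk : 0 < p * k by rewrite mulr_gt0.
have ln2 : 0 < ln 2 :> R by rewrite ln_gt0// ltr1n.
pose t s : R := D * tw (s%:R * p).
have t0 s : 0 < t s by rewrite mulr_gt0 ?tw_gt0.
have Dt s : D <= t s by rewrite ler_pMr// tw_ge1// mulr_ge0// ltW.
have lnD : 0 < ln (1 + D) by rewrite ln_gt0// ltrDl.
have lnmono a b : 0 <= a -> a <= b -> ln (1 + a) <= ln (1 + b) :> R.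
  by move=> a0 ab; rewrite ler_ln ?posrE ?lerD2l//; lra.
have ln0 a : 0 <= a -> 0 <= ln (1 + a) :> R.
  by move=> a0; apply: ln_ge0; lra.
have tS s : t s.+1 = t s * tw p.
  by rewrite /t -mulrA -twD; congr (_ * tw _); rewrite -nat1r; ring.
have p1 : 1 <= tw p by rewrite tw_ge1// ltW.
(* By [1 + 2 ^ p * t <= 2 ^ p * (1 + t)], the next mesh point adds at most [p * ln 2] to the
   logarithm, which is itself at least [ln (1 + D)]. *)
pose L := tw (p * k) * (1 + p * ln 2 / ln (1 + D)).
have mesh s : t s `^ k = D `^ k * tw (s%:R * (p * k)) by exact: powR_mesh.
have meshS s : tw (s.+1%:R * (p * k)) = tw (p * k) * tw (s%:R * (p * k)).
  by rewrite -twD; congr tw; rewrite -nat1r; ring.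
have phi_lt a b : 0 <= a -> a < b -> a `^ k * ln (1 + a) < b `^ k * ln (1 + b) :> R.
  move=> a0 ab; have b0 : 0 < b by exact: le_lt_trans ab.
  apply: (@le_lt_trans _ _ (a `^ k * ln (1 + b))).
    by rewrite ler_wpM2l ?powR_ge0// lnmono// ltW.
  by rewrite ltr_pM2r ?powR_lt// ln_gt0// ltrDl.
rewrite (choquet_bsum hS X (phi := fun x => x `^ k * ln (1 + x)) (p := p) (D := D)
  (l := tw (- (p * k))) (L := L)) ?tw_ge0//.
- split=> [|] h.
    (* From [N0] on, [D * 2 ^ (s p / 2) >= 1], so [ln (1 + t s) >= (s p / 2) * ln 2]; with
       [s + 1 <= 2 s] this gives the factor 4. *)
    pose N0 := (Num.truncn (2 * D^-1 / (p * ln 2))).+1.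
    apply: (@bsum_eventually _ N0 (4 / (p * ln 2) / D `^ k)) h.
    + by rewrite !divr_ge0// ?mulr_ge0// ltW.
    + by move=> s; rewrite /weighted -/(t s) !mulr_ge0 ?powR_ge0 ?(tailF_ge0 hS) ?ln0 ?(ltW (t0 s)).
    + move=> s sN; rewrite /weighted -/(t s) mesh [X in _ <= X]mulrA ler_wpM2r ?(tailF_ge0 hS)//.
      have hs : D^-1 <= tw (s%:R * p / 2).
        apply: le_trans (tw_ge_lin _).
        have : 2 * D^-1 / (p * ln 2) <= s%:R.
          by apply: le_trans (ltW (truncnS_gt _)) _; rewrite ler_nat.
        by rewrite ler_pdivrMr ?mulr_gt0//; lra.
      have s1 : (1 : R) <= s%:R by rewrite ler1n (leq_trans _ sN).
      have hl : s%:R * p / 2 * ln 2 <= ln (1 + t s).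
        rewrite -ln_tw ler_ln ?posrE ?tw_gt0//; last by rewrite addr_gt0.
        apply: (@le_trans _ _ (t s)); last by rewrite lerDr.
        have -> : t s = D * tw (s%:R * p / 2) * tw (s%:R * p / 2).
          by rewrite -mulrA -twD -splitr.
        by rewrite ler_peMl ?tw_ge0// -ler_pdivrMl// mulr1.
      have hl2 : s.+1%:R <= 4 / (p * ln 2) * ln (1 + t s).
        rewrite mulrAC ler_pdivlMr ?mulr_gt0// -nat1r.
        have : 1 * (p * ln 2) <= s%:R * (p * ln 2) by rewrite ler_wpM2r// ltW// mulr_gt0.
        lra.
      have -> : 4 / (p * ln 2) / D `^ k * (D `^ k * tw (s%:R * (p * k)) * ln (1 + t s)) =
        tw (s%:R * (p * k)) * (4 / (p * ln 2) * ln (1 + t s)).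
        by field; rewrite (gt_eqF p0) (gt_eqF ln2) (gt_eqF Dk).
      by rewrite ler_wpM2l ?tw_ge0.
  (* [1 + t s <= (1 + D) * 2 ^ (s p)] bounds the logarithm by a multiple of [s + 1]. *)
  apply: (bsum_le (C := D `^ k * (ln (1 + D) + p * ln 2))) h => [|s].
    by rewrite mulr_ge0 ?addr_ge0// ?mulr_ge0// ltW.
  rewrite /weighted -/(t s) mesh [X in _ <= X]mulrA ler_wpM2r ?(tailF_ge0 hS)//.
  rewrite [X in _ <= X]mulrACA ler_wpM2l ?mulr_ge0 ?tw_ge0 ?(ltW Dk)//.
  apply: (@le_trans _ _ (ln ((1 + D) * tw (s%:R * p)))).
    rewrite ler_ln ?posrE ?mulr_gt0 ?tw_gt0 ?addr_gt0//.
    by rewrite /t mulrDl mul1r lerD2r tw_ge1// mulr_ge0// ltW.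
  rewrite lnM ?posrE ?tw_gt0 ?addr_gt0// ln_tw -nat1r.
  have : 0 <= s%:R * ln (1 + D) by rewrite mulr_ge0// ltW.
  have : 0 <= p * ln 2 by rewrite mulr_ge0// ltW.
  by lra.
- exact: ltr_mono_nneg.
- by move=> a a0; rewrite mulr_ge0 ?powR_ge0 ?ln0.
- by rewrite tw_lt1// oppr_lt0.
- by rewrite mulr_ge0 ?tw_ge0// addr_ge0// divr_ge0 ?mulr_ge0// ltW.
- move=> s; rewrite -/(t s) -/(t s.+1) !mesh meshS twN.
  have -> : (tw (p * k))^-1 * (D `^ k * (tw (p * k) * tw (s%:R * (p * k))) * ln (1 + t s.+1)) =
     D `^ k * tw (s%:R * (p * k)) * ln (1 + t s.+1).
    by field; rewrite (gt_eqF (tw_gt0 _)).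
  rewrite ler_wpM2l ?mulr_ge0 ?tw_ge0 ?(ltW Dk)// lnmono ?(ltW (t0 _))// tS.
  by rewrite ler_peMr// ltW.
- move=> s; rewrite -/(t s) -/(t s.+1) !mesh meshS /L.
  have hl : ln (1 + t s.+1) <= (1 + p * ln 2 / ln (1 + D)) * ln (1 + t s).
    apply: (@le_trans _ _ (ln (tw p * (1 + t s)))).
      rewrite ler_ln ?posrE ?mulr_gt0 ?tw_gt0 ?addr_gt0// tS mulrDr mulr1 [t s * _]mulrC.
      by rewrite lerD2r.
    rewrite lnM ?posrE ?tw_gt0 ?addr_gt0// ln_tw mulrDl mul1r addrC lerD2l.
    rewrite mulrAC ler_pdivlMr// ler_wpM2l ?mulr_ge0 ?(ltW p0) ?(ltW ln2)//.
    by rewrite lnmono// ltW.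
  have -> : tw (p * k) * (1 + p * ln 2 / ln (1 + D)) * (D `^ k * tw (s%:R * (p * k)) * ln (1 + t s)) =
    D `^ k * (tw (p * k) * tw (s%:R * (p * k))) * ((1 + p * ln 2 / ln (1 + D)) * ln (1 + t s)) by ring.
  by rewrite ler_wpM2l// !mulr_ge0 ?tw_ge0// ltW.
Qed.

End MomentConditions.

(** * The equivalence *)

Section Main.
Set Implicit Arguments. Unset Strict Implicit. Unset Printing Implicit Defensive.
Context {d : measure_display} {Omega : measurableType d} {R : realType}.
Context (H : set (Omega -> R)) (E : (Omega -> R) -> \bar R).
Context (hS : sublinear_space H E).
Context (Xs : nat -> Omega -> R) (X : Omega -> R).
Context (HX : H X) (HXs : forall k, H (Xs k)).
Context (hind : forall n : nat, (0 < n)%N -> indep H E (fun i : 'I_n => Xs i) (Xs n)).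
Context (hid : forall k, ident_distr H E (Xs k) X).
Context (r p beta : R) (r1 : 1 < r) (p12 : 1 / 2 < p) (pb : 0 < beta + p).
Context (a : nat -> nat -> R) (c C : R) (c0 : 0 < c) (cC : c <= C).
Context (ha : forall n i : nat, (0 < n)%N -> (i <= n.-1)%N ->
  c * ((((n - i)%:R / n%:R) `^ beta) * ((1 / n%:R) `^ p)) <= a n i /\
  a n i <= C * ((((n - i)%:R / n%:R) `^ beta) * ((1 / n%:R) `^ p))).

Local Notation V := (Vr H E).
Local Notation F := (tailF H E X).
Local Notation sc := (scale p beta).
Local Notation rows := (rowsum F p beta).

Let p0 : 0 < p. Proof. by move: p12; lra. Qed.
Let r0 : 0 < r. Proof. by move: r1; lra. Qed.
Let C0 : 0 < C. Proof. exact: lt_le_trans cC. Qed.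

Let F0 : forall x, 0 <= F x. Proof. exact: (tailF_ge0 hS). Qed.
Let Fa : forall x y, x <= y -> F y <= F x. Proof. exact: (tailF_anti hS). Qed.

Let b n k := a n k.+1.

Let b_bounds n k : (k.+1 < n)%N ->
  c * (sc n (n - k.+1))^-1 <= b n k /\ b n k <= C * (sc n (n - k.+1))^-1.
Proof.
move=> kn; have n0 : (0 < n)%N by apply: leq_trans kn.
rewrite -weight_scale// ?subn_gt0//; apply: ha => //.
by rewrite -ltnS prednK.
Qed.

Let s0 n k : (k.+1 < n)%N -> 0 < sc n (n - k.+1).
Proof. by move=> kn; apply: scale_gt0; rewrite ?subn_gt0// (leq_trans _ kn). Qed.

Let b0 n k : (k.+1 < n)%N -> 0 < b n k.
Proof.
move=> kn; apply: lt_le_trans (b_bounds kn).1.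
by rewrite mulr_gt0 ?invr_gt0 ?s0.
Qed.

Let row_rev n (f : nat -> R) : \sum_(0 <= k < n.-1) f (n - k.+1)%N = \sum_(1 <= k < n) f k.
Proof.
case: n => [|n]; first by rewrite !big_geq.
rewrite [RHS]big_add1/= big_nat_rev/=; apply: eq_big_nat => k /andP[_ kn].
by rewrite add0n; congr f; lia.
Qed.

Let decay_le n eps : (0 < n)%N -> 0 < eps ->
  1 - expR (- rows (2 * eps / c) n) <= V (exceed Xs (b n) n eps).
Proof.
move=> n0 eps0; rewrite -[in exceed _ _ _ _](prednK n0).
rewrite /rowsum -(row_rev n (fun k => F (2 * eps / c * (sc n k)))).
apply: (exceed_ge hS HX HXs hind hid) => k kn.
have kn' : (k.+1 < n)%N by rewrite -(prednK n0) ltnS.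
split; first exact: b0.
have [h _] := b_bounds kn'; have s1 := s0 kn'.
apply: (@le_trans _ _ (c * (sc n (n - k.+1))^-1 * (2 * eps / c * sc n (n - k.+1)))).
  by rewrite le_eqVlt; apply/orP; left; apply/eqP; field; rewrite !gt_eqF.
by rewrite (prednK n0) ler_wpM2r// mulr_ge0 ?divr_ge0 ?mulr_ge0// ltW.
Qed.

Definition sums eps n : R := n%:R `^ (r - 2) * V (exceed Xs (fun k => a n k.+1) n eps).

Let sums_ge0 eps n : 0 <= sums eps n.
Proof. by rewrite mulr_ge0 ?powR_ge0 ?(Vr_ge0 hS). Qed.

Lemma decay_of_sums : (forall eps, 0 < eps -> bsum (sums eps)) ->
  forall D, 0 < D -> bsum (ydecay F p beta r D).
Proof.
move=> h D D0; have e0 : 0 < c * D / 2 by rewrite divr_gt0// mulr_gt0.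
apply: (@bsum_eventually _ 1 1 _ (sums (c * D / 2))) (h _ e0) => // n n1.
rewrite mul1r /ydecay /sums ler_wpM2l ?powR_ge0//.
have := decay_le n1 e0.
suff -> : 2 * (c * D / 2) / c = D by [].
by field; rewrite gt_eqF.
Qed.

(** [q] is the midpoint between [1 / p] and the minimum of [r / p] and [M], an interval that is
    nonempty by [r > 1] and [p > 1 / 2]. When [p > 1] the smaller bound [M = 1] is still above
    [1 / p], and the case [q <= 1] of [mean_clip] applies. *)
Let exponent : exists q : R, [/\ 1 < p * q, p * q < r, q <= 2 & q <= 1 \/ (1 <= q /\ p <= 1)].
Proof.
have p1' : p^-1 < 2 by rewrite invf_plt ?posrE//; move: p12; lra.
have rp : p^-1 < r / p by rewrite -[X in X < _]mul1r ltr_pM2r ?invr_gt0.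
pose M : R := if p <= 1 then 2 else 1.
have M2 : M <= 2 by rewrite /M; case: ifP => // _; rewrite ler1n.
have pM : p^-1 < M.
  by rewrite /M; case: ifPn => // p1; rewrite invf_lt1// ltNge.
pose mm := Num.min M (r / p).
have mM : mm <= M by rewrite ge_min lexx.
have mr : mm <= r / p by rewrite ge_min lexx orbT.
have pm : p^-1 < mm by rewrite lt_min pM rp.
have pp : p * p^-1 = 1 by rewrite divff// gt_eqF.
have pr : p * (r / p) = r by field; rewrite gt_eqF.
exists ((p^-1 + mm) / 2); split.
- by rewrite -[X in X < _]pp ltr_pM2l//; lra.
- by rewrite -[X in _ < X]pr ltr_pM2l//; lra.
- by lra.
- have [p1|p1] := leP p 1; [right|left].
    split=> //; have : 1 <= p^-1 by rewrite invf_ge1.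
    by lra.
  have M1 : M = 1 by rewrite /M leNgt p1.
  by move: mM; rewrite M1; lra.
Qed.

Lemma sums_bsum (hmean : p <= 1 -> E X = 0%E /\ E (fun w => - X w) = 0%E) :
  bsum (weighted F p 1 (whigh r)) ->
  (forall D, 0 < D -> bsum (fun n => n%:R `^ (r - 2) * rows D n)) ->
  forall eps, 0 < eps -> bsum (sums eps).
Proof.
move=> hw hrow eps eps0.
have [q [q1 q2 q3 q4]] := exponent.
have q0 : 0 < q by rewrite -(pmulr_rgt0 _ p0); apply: lt_trans q1.
have [K [K0 hK]] : exists K : R, 0 < K /\ forall Y, H Y -> (forall w, 0 <= Y w) ->
    (forall w, Y w <= `|X w| `^ q) -> (E Y <= K%:E)%E.
  apply: (E_le_moment hS (p := p)) => //.
  have [B [B0 hB]] : exists B : R, 0 < B /\ forall s, weighted F p 1 (whigh r) s <= B.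
    by apply: bsum_bounded hw => s; rewrite mulr_ge0 ?tw_ge0.
  (* Boundedness of [2 ^ (s r) * F (2 ^ (s p))] turns into geometric decay since [p q < r]. *)
  apply: (bsum_le (C := B) (v := fun s => tw (s%:R * (p * q - r)))) => [|s|].
  - exact: ltW.
  - apply: le_trans (ler_wpM2r (tw_ge0 _) (hB s)).
    rewrite /weighted /whigh mulrAC -twD ler_wpM2r// tw_le//; lra.
  - by apply: bsum_tw; rewrite subr_lt0.
(* Above [1 / q] for summability over [k], at least [- beta] for [scale_inv_le], and below [p] so
   that the row sums decay like [n ^ (- q (p - bb))]. *)
pose bb := (Num.max (- beta) q^-1 + p) / 2.
have iq : q^-1 < p by rewrite invf_plt ?posrE// -ltr_pdivrMl// mulr1 in q1 *; move: q1; rewrite -[X in X < _]mulr1 ltr_pdivrMl.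
have mx : Num.max (- beta) q^-1 < p by rewrite gt_max iq andbT; move: pb; lra.
have mx1 : - beta <= Num.max (- beta) q^-1 by rewrite le_max lexx.
have mx2 : q^-1 <= Num.max (- beta) q^-1 by rewrite le_max lexx orbT.
have bb1 : - beta <= bb by rewrite /bb; lra.
have bbq : 1 < bb * q by rewrite -ltr_pdivrMr// mul1r /bb; lra.
have bbp : 0 < p - bb by rewrite /bb; lra.
pose sg := q * (p - bb); have sg0 : 0 < sg by rewrite mulr_gt0.
have [B [B0 hB]] := @sum_scale_powR _ p beta bb q q0 bb1 bbq.
(* With [t = L * ln n] these constants give [expR (- (t * eps)) = n ^ (- r)] and
   [expR (t * eta) = n ^ (sg / 2)], which spends half of the decay [n ^ (- sg)]. *)
pose L := r / eps; have L0 : 0 < L by rewrite divr_gt0.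
pose eta := sg / (2 * L); have eta0 : 0 < eta by rewrite divr_gt0// mulr_gt0.
pose S := C `^ q * B; have S0 : 0 < S by rewrite mulr_gt0// powR_gt0.
have powb n : (1 < n)%N -> \sum_(0 <= k < n.-1) b n k `^ q <= S * n%:R `^ (- sg).
  move=> n1; rewrite /S -mulrA.
  apply: le_trans (ler_wpM2l (powR_ge0 C q) (hB n (ltnW n1))).
  rewrite mulr_sumr -(row_rev n (fun k => C `^ q * (sc n k)^-1 `^ q)).
  apply: ler_sum_nat => k /andP[_ kn].
  have kn' : (k.+1 < n)%N by rewrite -(prednK (ltnW n1)) ltnS.
  have s1 := s0 kn'; have b1 := b0 kn'.
  rewrite -powRM ?invr_ge0 ?(ltW C0) ?(ltW s1)//.
  apply: ge0_ler_powR; rewrite ?nnegrE ?mulr_ge0 ?invr_ge0 ?(ltW q0) ?(ltW b1) ?(ltW C0) ?(ltW s1)//.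
  by have [] := b_bounds kn'.
pose K1 := eta `^ (1 - q) * K; pose K2 := eta `^ (2 - q) * K.
have K10 : 0 < K1 by rewrite mulr_gt0// powR_gt0.
have K20 : 0 < K2 by rewrite mulr_gt0// powR_gt0.
(* Bounds the exponent uniformly in [n], by [ln n <= n ^ sg / sg] and [(ln n) ^ 2 <= (16 / sg ^ 2) *
   n ^ (sg / 2)]. *)
pose C2 := L * K1 * S / sg + L ^+ 2 * K2 * S * (16 / sg ^+ 2).
have D0 : 0 < eta / C by rewrite divr_gt0.
have h2 : bsum (fun n => if n is 0 then 0 else n%:R `^ (-2) : R) by apply: bsum_powR; lra.
have e20 : 0 <= 2 * expR C2 by rewrite mulr_ge0 ?expR_ge0.
have bs2 := bsumD (hrow _ D0) (bsum_le e20 (fun n => lexx _) h2).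
(* [n >= 2] ensures [ln n > 0], hence [t > 0]; the exponential term sums like
   [n ^ (r - 2) * n ^ (- r) = n ^ (- 2)]. *)
apply: (@bsum_eventually _ 2 1) bs2 => //.
  move=> n; rewrite addr_ge0// ?mulr_ge0 ?powR_ge0 ?rowsum_ge0 ?expR_ge0//.
  by case: n => // n; exact: powR_ge0.
move=> n n1; have n0 : (0 < n)%N := ltnW n1.
have n0' : (0 : R) < n%:R by rewrite ltr0n.
have n1' : (1 : R) <= n%:R by rewrite ler1n.
pose t := L * ln n%:R.
have ln0 : 0 < ln n%:R :> R by rewrite ln_gt0// ltr1n.
have t0 : 0 < t by rewrite mulr_gt0.
have expE x : expR (x * ln n%:R) = n%:R `^ x :> R by rewrite /powR gt_eqF.
have et : expR (t * eta) = n%:R `^ (sg / 2).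
  by rewrite -expE; congr expR; rewrite /t /eta; field; rewrite gt_eqF.
have ee : expR (- (t * eps)) = n%:R `^ (- r).
  by rewrite -expE; congr expR; rewrite /t /L; field; rewrite gt_eqF.
have kn' k : (k < n.-1)%N -> (k.+1 < n)%N by move=> h; rewrite -(prednK n0) ltnS.
have hmn : q <= 1 \/ 1 <= q /\ E X = 0%E /\ E (fun w => - X w) = 0%E.
  by case: q4 => [|[h1 h2']]; [left|right; split=> //; exact: hmean].
have := @exceed_le_clip _ _ _ _ _ hS Xs X HX HXs hind hid eta eta0 (b n) n.-1 eps t
  (fun k => eta `^ (1 - q) * b n k `^ q * K) (fun k => eta `^ (2 - q) * b n k `^ q * K) t0 eps0.
rewrite (prednK n0) => hV.
rewrite mul1r /sums.
apply: (@le_trans _ _ (n%:R `^ (r - 2) * (rows (eta / C) n + 2 * (n%:R `^ (- r) * expR C2)))).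
  rewrite ler_wpM2l ?powR_ge0//; apply: le_trans (hV _ _ _) _.
  - by move=> k kn; split; [exact: b0 (kn' k kn)|rewrite !mulr_ge0 ?powR_ge0// ltW..].
  - by move=> k s kn; apply: (mean_clip hS HX HXs hid) => //; exact: b0 (kn' k kn).
  - by move=> k kn; apply: (second_moment_clip hS HX HXs hid) => //; exact: b0 (kn' k kn).
  apply: lerD.
    rewrite /rowsum -(row_rev n (fun k => F (eta / C * sc n k))).
    apply: ler_sum_nat => k /andP[_ kn]; apply: Fa.
    have b1 := b0 (kn' k kn); have s1 := s0 (kn' k kn).
    rewrite -mulrA ler_pM2l// -[sc _ _]invrK -invfM lef_pV2 ?posrE ?mulr_gt0 ?invr_gt0//.
    by have [] := b_bounds (kn' k kn).
  rewrite ler_wpM2l// ee ler_wpM2l ?powR_ge0// ler_expR.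
  set Sb := \sum_(0 <= k < n.-1) b n k `^ q.
  have -> : \sum_(0 <= k < n.-1) (t * (eta `^ (1 - q) * b n k `^ q * K) +
      t ^+ 2 * expR (t * eta) * (eta `^ (2 - q) * b n k `^ q * K)) =
      (t * K1 + t ^+ 2 * expR (t * eta) * K2) * Sb.
    by rewrite mulr_sumr; apply: eq_bigr => k _; rewrite /K1 /K2; ring.
  apply: (@le_trans _ _ ((t * K1 + t ^+ 2 * expR (t * eta) * K2) * (S * n%:R `^ (- sg)))).
    apply: ler_wpM2l (powb n n1); apply: addr_ge0; apply: mulr_ge0.
    - exact: ltW.
    - exact: ltW.
    - by rewrite mulr_ge0 ?sqr_ge0 ?expR_ge0.
    - exact: ltW.
  rewrite et mulrDl /C2; apply: lerD.
    have hl : ln n%:R * n%:R `^ (- sg) <= sg^-1 :> R.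
      by rewrite powRN ler_pdivrMr ?powR_gt0//; exact: ln_le_powR.
    have -> : t * K1 * (S * n%:R `^ (- sg)) = L * K1 * S * (ln n%:R * n%:R `^ (- sg)).
      by rewrite /t; ring.
    by apply: ler_wpM2l hl; exact: ltW (mulr_gt0 (mulr_gt0 L0 K10) S0).
  have hl : ln n%:R ^+ 2 * (n%:R `^ (sg / 2) * n%:R `^ (- sg)) <= 16 / sg ^+ 2 :> R.
    have s4 : 0 < sg / 4 by rewrite divr_gt0.
    have h := ln_le_powR n1' s4.
    rewrite -powRD; last by rewrite (gt_eqF n0') implybT.
    have -> : sg / 2 - sg = - (sg / 4 + sg / 4) by lra.
    rewrite powRN ler_pdivrMr ?powR_gt0// powRD; last by rewrite (gt_eqF n0') implybT.
    have -> : 16 / sg ^+ 2 * (n%:R `^ (sg / 4) * n%:R `^ (sg / 4)) =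
       ((sg / 4)^-1 * n%:R `^ (sg / 4)) ^+ 2 :> R.
      by field; rewrite gt_eqF.
    by rewrite ler_sqr ?nnegrE ?(ltW ln0)// mulr_ge0 ?powR_ge0// invr_ge0 ltW.
  have -> : t ^+ 2 * n%:R `^ (sg / 2) * K2 * (S * n%:R `^ (- sg)) =
     L ^+ 2 * K2 * S * (ln n%:R ^+ 2 * (n%:R `^ (sg / 2) * n%:R `^ (- sg))).
    by rewrite /t; ring.
  by apply: ler_wpM2l hl; exact: ltW (mulr_gt0 (mulr_gt0 (exprn_gt0 2 L0) K20) S0).
rewrite mulrDr lerD2l; case: n n1 n0 n0' {n1' t ln0 t0 expE et ee kn' hV} => // n _ _ n0'.
have -> : n.+1%:R `^ (r - 2) * (2 * (n.+1%:R `^ (- r) * expR C2)) =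
  2 * expR C2 * (n.+1%:R `^ (r - 2) * n.+1%:R `^ (- r)) :> R by ring.
rewrite -powRD; last by rewrite (gt_eqF n0') implybT.
by have -> : r - 2 - r = - 2 by lra.
Qed.

End Main.

Section WeightedSeries.
Set Implicit Arguments. Unset Strict Implicit. Unset Printing Implicit Defensive.
Context {d : measure_display} {Omega : measurableType d} {R : realType}.
Context (H : set (Omega -> R)) (E : (Omega -> R) -> \bar R).
Context (hS : sublinear_space H E) (Xs : nat -> Omega -> R).
Context (r : R) (a : nat -> nat -> R).

(** The default 0 of the maximum never exceeds [eps > 0], so a crossing happens at an actual index
    [j]. *)
Lemma exceedE (n : nat) (eps : R) : 0 < eps ->
  [set w | (eps < \big[Num.max/0]_(j < n) `|\sum_(i < j) a n i.+1 * Xs i w|)%R] =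
  exceed Xs (fun k => a n k.+1) n eps.
Proof.
move=> eps0; apply/seteqP; split => w /=.
  move=> /bigmax_gtP [h|[j _ hj]]; first by move: (lt_trans h eps0); rewrite ltxx.
  by exists j; split=> //; rewrite big_mkord.
move=> [j [jn hj]]; apply/bigmax_gtP; right; exists (Ordinal jn) => //=.
by rewrite big_mkord in hj.
Qed.

Lemma series_sums (eps : R) : 0 < eps ->
  (\sum_(1 <= n <oo) ((n%:R `^ (r - 2))%:E * capV H E
     [set w | (eps < \big[Num.max/0]_(j < n) `|\sum_(i < j) a n i.+1 * Xs i w|)%R]) < +oo)%E <->
  bsum (sums H E Xs r a eps).
Proof.
move=> eps0; rewrite -nneseries1_bsum; last first.
  by move=> n; rewrite mulr_ge0 ?powR_ge0 ?(Vr_ge0 hS).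
rewrite (eq_eseriesr (g := fun n => (sums H E Xs r a eps n)%:E))// => n _.
by rewrite exceedE// (capVE hS) -EFinM.
Qed.

End WeightedSeries.

(* Xs k stands for X_{k+1}; a n i stands for a_{ni}. *)
Theorem theorem2 (d : measure_display) (Omega : measurableType d) (R : realType)
  (H : set (Omega -> R)) (E : (Omega -> R) -> \bar R)
  (hS : sublinear_space H E)
  (Xs : nat -> Omega -> R) (X : Omega -> R)
  (HX : H X) (HXs : forall k, H (Xs k))
  (hind : forall n : nat, (0 < n)%N -> indep H E (fun i : 'I_n => Xs i) (Xs n))
  (hid : forall k, ident_distr H E (Xs k) X)
  (r p beta : R) (hr : 1 < r) (hp : 1 / 2 < p) (hbp : 0 < beta + p)
  (hmean : p <= 1 -> E X = 0%E /\ (- E (fun w => (- X w)%R) = 0)%E)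
  (a : nat -> nat -> R)
  (ha : exists c C : R, 0 < c /\ c <= C /\
     forall n i : nat, (0 < n)%N -> (i <= n.-1)%N ->
       c * ((((n - i)%:R / n%:R) `^ beta) * ((1 / n%:R) `^ p)) <= a n i /\
       a n i <= C * ((((n - i)%:R / n%:R) `^ beta) * ((1 / n%:R) `^ p))) :
  let V := capV H E in
  ((beta < - p / r ->
      (choquetE V (fun w => (`|X w| `^ ((r - 1) / (p + beta)))%R) < +oo)%E) /\
   (beta = - p / r ->
      (choquetE V (fun w => (`|X w| `^ (r / p) * ln (1 + `|X w|))%R) < +oo)%E) /\
   (- p / r < beta ->
      (choquetE V (fun w => (`|X w| `^ (r / p))%R) < +oo)%E))
  <->
  (forall eps : R, 0 < eps ->
     (\sum_(1 <= n <oo)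
        ((n%:R `^ (r - 2))%:E *
         V [set w | (eps < \big[Num.max/0]_(j < n)
                             `| \sum_(i < j) a n i.+1 * Xs i w |)%R]) < +oo)%E).
Proof.
move=> V; have [c [C [c0 [cC hac]]]] := ha.
have p0 : 0 < p by lra.
have r0 : 0 < r by lra.
have pb : 0 < p + beta by lra.
have hm : p <= 1 -> E X = 0%E /\ E (fun w => - X w) = 0%E.
  by move=> /hmean[h1 /eqP]; rewrite oppe_eq0 => /eqP.
pose F := tailF H E X.
have F0 : forall x, 0 <= F x by exact: (tailF_ge0 hS).
have Fa : forall x y, x <= y -> F y <= F x by exact: (tailF_anti hS).
have low D : 0 < D -> (choquetE V (fun w => (`|X w| `^ ((r - 1) / (p + beta)))%R) < +oo)%E <->
    bsum (weighted F p D (wlow p beta r)).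
  move=> D0; have -> : wlow p beta r = (fun s => tw (s%:R * (p * ((r - 1) / (p + beta))))).
    by apply/funext => s; rewrite /wlow; congr (tw (_ * _)); rewrite mulrA [p * _]mulrC.
  by apply: choquet_powR => //; rewrite divr_gt0// subr_gt0.
have prp : p * (r / p) = r by field; rewrite gt_eqF.
have rp0 : 0 < r / p by rewrite divr_gt0.
have crit D : 0 < D -> (choquetE V (fun w => (`|X w| `^ (r / p) * ln (1 + `|X w|))%R) < +oo)%E <->
    bsum (weighted F p D (wcrit r)).
  by move=> D0; rewrite (choquet_powR_ln hS X rp0 p0 D0) prp.
have high D : 0 < D -> (choquetE V (fun w => (`|X w| `^ (r / p))%R) < +oo)%E <->
    bsum (weighted F p D (whigh r)).
  by move=> D0; rewrite (choquet_powR hS X rp0 p0 D0) prp.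
split=> [[hlow [hcrit hhigh]] eps eps0|h].
  apply/(series_sums hS) => //.
  (* The truncated sums use the moment of order [r / p] in each regime; for [beta <= - p / r] it
     follows from the stronger condition in (i). *)
  suff [hw hrow] : bsum (weighted F p 1 (whigh r)) /\
      (forall D, 0 < D -> bsum (fun n => n%:R `^ (r - 2) * rowsum F p beta D n)).
    exact: (sums_bsum hS HX HXs hind hid hr hp hbp c0 cC hac hm hw hrow).
  have [hb|hb|hb] := ltgtP beta (- p / r).
  - have hw D (D0 : 0 < D) := (low D D0).1 (hlow hb).
    split; last exact: (wlow_rowsum F0 Fa p0 pb hr hb hw).
    apply: (bsum_le (C := 1)) (hw 1 ltr01) => // s.
    rewrite mul1r /weighted ler_wpM2r// tw_le// ler_wpM2l//.
    rewrite ler_pdivlMr//; move: hb; rewrite ltr_pdivlMr//; lra.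
  - have hw D (D0 : 0 < D) := (high D D0).1 (hhigh hb).
    by split; [exact: hw|exact: (whigh_rowsum F0 Fa p0 pb hr hb hw)].
  - have hw D (D0 : 0 < D) := (crit D D0).1 (hcrit hb).
    split; last exact: (wcrit_rowsum F0 Fa p0 pb hr hb hw).
    apply: (bsum_le (C := 1)) (hw 1 ltr01) => // s.
    by rewrite mul1r /weighted ler_wpM2r// /wcrit ler_peMr ?tw_ge0// ler1n.
have hy : forall D, 0 < D -> bsum (ydecay F p beta r D).
  apply: (decay_of_sums hS HX HXs hind hid hr hp hbp c0 cC hac) => eps eps0.
  by apply/(series_sums hS) => //; exact: h.
split; [|split] => hb.
- by apply/(low 1) => //; exact: (decay_wlow F0 Fa p0 pb hr hb hy).
- by apply/(crit 1) => //; exact: (decay_wcrit F0 Fa p0 pb hr hb hy).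
- by apply/(high 1) => //; exact: (decay_whigh F0 Fa pb hr hy).
Qed.
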